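(* Let $V$ and $X$ be separable reflexive Banach spaces with duals $V^*$, $X^*$, let $0<T<+\infty$, and let $K\subset V$ be a nonempty, closed and convex set. Let $M\colon V\to X$ be a linear, continuous and compact operator, with $\|M\|=\|M\|_{\mathcal L(V,X)}$. Assume the following. (1) $A\colon (0,T)\times V\to V^*$ satisfies: (a) $A(\cdot,v)$ is measurable on $(0,T)$ for all $v\in V$; (b) there exists $m_A>0$ such that $\langle A(t,v_1)-A(t,v_2),v_1-v_2\rangle_{V^*\times V}\ge m_A\|v_1-v_2\|_V^2$ for all $v_1,v_2\in V$ and a.e. $t\in(0,T)$; (c) $A(t,\cdot)$ is continuous on $V$ for a.e. $t\in(0,T)$; (d) $\|A(t,v)\|_{V^*}\le a_0(t)+a_1\|v\|_V$ for all $v\in V$, a.e. $t\in(0,T)$, with $a_0\in L^2(0,T)$, $a_0\ge 0$ and $a_1>0$; (e) there exist $\alpha_A>0$, $\beta\in\mathbb R$, $\beta_1\in L^2(0,T)$ and $u_0\in K$ such that $\langle A(t,v),v-u_0\rangle_{V^*\times V}\ge \alpha_A\|v\|_V^2-\beta\|v\|_V-\beta_1(t)$ for all $v\in V$ and a.e. $t\in(0,T)$. (2) $\mathcal S\colon L^2(0,T;V)\to L^2(0,T;V^* )$ is a history-dependent operator: there is $L_{\mathcal S}>0$ such that $$\|(\mathcal Su_1)(t)-(\mathcal Su_2)(t)\|_{V^*}\le L_{\mathcal S}\int_0^t\|u_1(s)-u_2(s)\|_V\,ds$$ for all $u_1,u_2\in L^2(0,T;V)$ and a.e. $t\in(0,T)$.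 (3) $\tilde\varphi\colon V^*\times K\times K\to\mathbb R$ satisfies: (a) $\tilde\varphi(w,u,\cdot)\colon K\to\mathbb R$ is convex and lower semicontinuous on $K$ for all $w\in V^*$, $u\in K$; (b) there exists $\alpha_{\tilde\varphi}>0$ such that $$\tilde\varphi(w_1,u_1,v_2)-\tilde\varphi(w_1,u_1,v_1)+\tilde\varphi(w_2,u_2,v_1)-\tilde\varphi(w_2,u_2,v_2)\le\alpha_{\tilde\varphi}\big(\|u_1-u_2\|_V+\|w_1-w_2\|_{V^*}\big)\|v_1-v_2\|_V$$ for all $w_1,w_2\in V^*$ and $u_1,u_2,v_1,v_2\in K$. (4) $J\colon(0,T)\times X\to\mathbb R$ satisfies: (a) $J(\cdot,v)$ is measurable on $(0,T)$ for all $v\in X$; (b) $J(t,\cdot)$ is locally Lipschitz on $X$ for a.e. $t\in(0,T)$; (c) $\|\partial J(t,v)\|_{X^*}\le c_0(t)+c_1\|v\|_X$ for all $v\in X$, a.e. $t\in(0,T)$, with $c_0\in L^2(0,T)$ and $c_0,c_1\ge 0$; (d) $J(t,\cdot)$ or $-J(t,\cdot)$ is regular in the sense of Clarke on $X$ for a.e. $t\in(0,T)$; (e) there exists $m_J>0$ such that $J^0(t,v_1;v_2-v_1)+J^0(t,v_2;v_1-v_2)\le m_J\|v_1-v_2\|_X^2$ for all $v_1,v_2\in X$ and a.e. $t\in(0,T)$. (5) $f\in L^2(0,T;V^* )$, $\ m_A>\alpha_{\tilde\varphi}+m_J\|M\|^2$ and $\alpha_A>2m_J\|M\|^2$. Then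 there exists a unique $u\in L^2(0,T;V)$ such that $u(t)\in K$ for a.e. $t\in(0,T)$ and $$\langle A(t,u(t)),v-u(t)\rangle_{V^*\times V}+\tilde\varphi((\mathcal Su)(t),u(t),v)-\tilde\varphi((\mathcal Su)(t),u(t),u(t))+J^0(t,Mu(t);M(v-u(t)))\ge\langle f(t),v-u(t)\rangle_{V^*\times V}$$ for all $v\in K$ and a.e. $t\in(0,T)$.
   Context: For a locally Lipschitz function $h\colon X\to\mathbb R$ on a Banach space $X$, the Clarke generalized directional derivative at $x\in X$ in the direction $v\in X$ is $h^0(x;v)=\limsup_{y\to x,\ \lambda\downarrow 0}\frac{h(y+\lambda v)-h(y)}{\lambda}$, and the Clarke subdifferential is $\partial h(x)=\{\zeta\in X^*: h^0(x;v)\ge\langle\zeta,v\rangle_{X^*\times X}\text{ for all }v\in X\}$. For $J\colon(0,T)\times X\to\mathbb R$, $J^0(t,x;v)$ and $\partial J(t,x)$ denote the generalized directional derivative and the Clarke subdifferential of $J(t,\cdot)$ with $t$ fixed. The notation $\|\partial J(t,v)\|_{X^*}\le C$ means $\|\zeta\|_{X^*}\le C$ for every $\zeta\in\partial J(t,v)$. A locally Lipschitz function is regular in the sense of Clarke if at every point its one-sided directional derivative exists in every direction and equals the generalized directional derivative. $\mathcal L(V,X)$ is the space of bounded linear operators from $V$ to $X$ with the operator norm. *)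

(* Defs.v *)
From HB Require Import structures.
From mathcomp Require Import all_boot all_order all_algebra.
From mathcomp Require Import all_classical all_reals all_analysis.
Set Implicit Arguments.
Unset Strict Implicit.
Unset Printing Implicit Defensive.
Import Order.TTheory GRing.Theory Num.Theory.
Import numFieldNormedType.Exports.
Local Open Scope classical_set_scope.
Local Open Scope ring_scope.

Section BoundedOperators.
Context (R : realType) (V W : normedModType R).

Definition is_blin : {pred V -> W} :=
  mem [set f : V -> W | linear f /\ continuous f].

(* Bounded linear operators from V to W, normed by [opnorm] below. *)
Record blin := Blin { blin_fun :> V -> W; _ : blin_fun \in is_blin }.

HB.instance Definition _ := [isSub for blin_fun].
HB.instance Definition _ := [Choice of blin by <:].

Lemma is_blinP (f : V -> W) : (f \in is_blin) <-> linear f /\ continuous f.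
Proof. by split=> [|fP]; rewrite inE. Qed.

Lemma is_blin_submod_closed : submod_closed is_blin.
Proof.
split=> [|a f g /is_blinP[lf cf] /is_blinP[lg cg]]; apply/is_blinP; split.
- by move=> a x y; rewrite /= scaler0 addr0.
- by move=> x; exact: cvg_cst.
- move=> b x y; rewrite /= !fctE lf lg !scalerDr !scalerA mulrC.
  by rewrite -!addrA; congr (_ + _); rewrite addrCA.
- move=> x; apply: cvgD; last exact: cg.
  by apply: cvgZl_tmp; exact: cf.
Qed.

HB.instance Definition _ := GRing.isSubmodClosed.Build R (V -> W) is_blin
  is_blin_submod_closed.
HB.instance Definition _ := [SubChoice_isSubLmodule of blin by <:].

Lemma blin_linear (f : blin) : linear f.
Proof. by have /is_blinP[] := valP f. Qed.

Lemma blin_continuous (f : blin) : continuous f.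
Proof. by have /is_blinP[] := valP f. Qed.

HB.instance Definition _ (f : blin) :=
  GRing.isLinear.Build R V W *:%R (blin_fun f) (@blin_linear f).

Definition opnorm (f : blin) : R :=
  sup [set `|f x| | x in [set x : V | `|x| <= 1]].

Let has_sup_opnorm (f : blin) :
  has_sup [set `|f x| | x in [set x : V | `|x| <= 1]].
Proof.
split; first by exists `|f 0|, 0 => //=; rewrite normr0.
have /bounded_funP/(_ 1)[M fM] : bounded_near f (nbhs (0 : V)).
  exact/linear_bounded_continuous/blin_continuous.
by exists M => _ [x /= x1 <-]; exact: fM.
Qed.

Let opnorm_ub (f : blin) (x : V) : `|x| <= 1 -> `|f x| <= opnorm f.
Proof.
by move=> x1; apply: ub_le_sup; [case: (has_sup_opnorm f)|exists x].
Qed.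

Let opnorm_le (f : blin) (c : R) :
  (forall x : V, `|x| <= 1 -> `|f x| <= c) -> opnorm f <= c.
Proof.
move=> fc; apply: ge_sup; first by case: (has_sup_opnorm f).
by move=> _ [x /= x1 <-]; exact: fc.
Qed.

Let opnorm_ge0 (f : blin) : 0 <= opnorm f.
Proof. by apply: le_trans (opnorm_ub f (x := 0) _); rewrite ?normr0. Qed.

Lemma opnormP (f : blin) (x : V) : `|f x| <= opnorm f * `|x|.
Proof.
have [->|x0] := eqVneq x 0; first by rewrite linear0 !normr0 mulr0.
have := opnorm_ub f (x := `|x|^-1 *: x).
rewrite linearZ !normrZ !normfV normr_id mulVf ?normr_eq0//.
by move=> /(_ (lexx _)); rewrite mulrC ler_pdivrMr ?normr_gt0.
Qed.

Let ler_opnormD (f g : blin) : opnorm (f + g) <= opnorm f + opnorm g.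
Proof.
apply: opnorm_le => x x1; apply: le_trans (ler_normD _ _) _.
by apply: lerD; exact: opnorm_ub.
Qed.

Let opnormZ_le (a : R) (f : blin) : opnorm (a *: f) <= `|a| * opnorm f.
Proof.
apply: opnorm_le => x x1; rewrite [X in `|X|](_ : _ = a *: f x)//.
by rewrite normrZ ler_wpM2l// opnorm_ub.
Qed.

Let opnormZ (a : R) (f : blin) : opnorm (a *: f) = `|a| * opnorm f.
Proof.
apply/eqP; rewrite eq_le opnormZ_le/=.
have [->|a0] := eqVneq a 0; first by rewrite normr0 mul0r.
rewrite -ler_pdivlMl ?normr_gt0// -normfV.
by apply: le_trans (opnormZ_le _ _); rewrite scalerA mulVf// scale1r.
Qed.

Let opnorm_eq0 (f : blin) : opnorm f = 0 -> f = 0.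
Proof.
move=> f0; apply/val_inj/funext => x; apply/eqP.
by rewrite -normr_le0 (le_trans (opnormP f x))// f0 mul0r.
Qed.

HB.instance Definition _ :=
  Lmodule_isNormed.Build R blin ler_opnormD opnormZ opnorm_eq0.

End BoundedOperators.

Section Dual.
Context (R : realType) (V : normedModType R).

Definition dual : Type := blin V R^o.
HB.instance Definition _ := NormedModule.on dual.

End Dual.

Section BanachSpaceNotions.
Context (R : realType).

Definition separable (T : topologicalType) : Prop :=
  exists2 S : set T, countable S & dense S.

Definition reflexive_space (V : normedModType R) : Prop :=
  forall F : dual (dual V), exists v : V, forall z : dual V, F z = z v.

Definition compact_operator (V W : normedModType R) (f : V -> W) : Prop :=
  forall B : set V, bounded_set B -> precompact (f @` B).

End BanachSpaceNotions.

Section Clarke.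
Context (R : realType) (X : normedModType R).
Implicit Types (h : X -> R) (x v : X).

Definition locally_lipschitz h : Prop :=
  forall x, exists2 U : set X, nbhs x U & [lipschitz (h y : R^o) | y in U].

Definition diff_quot h v (p : X * R) : R := (h (p.1 + p.2 *: v) - h p.1) / p.2.

(* Extended-real valued so that the limsup is total; it is finite when [h] is
   locally Lipschitz. The filter lets [y = x], as the limsup does. *)
Definition clarke_deriv h x v : \bar R :=
  limf_esup (fun p : X * R => (diff_quot h v p)%:E)
            (filter_prod (nbhs x) (0 : R)^'+).

Definition clarke_subdiff h x : set (dual X) :=
  [set zeta | forall v, ((zeta v)%:E <= clarke_deriv h x v)%E].

Definition clarke_regular h : Prop :=
  forall x v,
    (diff_quot h v (x, l))%:E @[l --> (0 : R)^'+] --> clarke_deriv h x v.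

End Clarke.

Section Bochner.
Context (R : realType).
Local Notation mu := (@lebesgue_measure R).

Definition ae_in (T : R) (P : R -> Prop) : Prop :=
  \forall t \ae mu, `]0, T[%classic t -> P t.

Instance ae_in_filter (T : R) : Filter (ae_in T).
Proof.
have F := ae_filter_ringOfSetsType mu.
split; first exact: (@filterE _ _ F).
- move=> P Q; apply: (@filterS2 _ _ F) => t p q t0.
  by split; [exact: p|exact: q].
- by move=> P Q PQ; apply: (@filterS _ _ F) => t p /p /PQ.
Qed.

Context (V : normedModType R).
Implicit Types (T : R) (u v : R -> V).

Definition simple_fun (s : R -> V) : Prop :=
  finite_set (range s) /\ forall x, measurable (s @^-1` [set x]).

(* Because the limit is only required almost everywhere, for V = R this is
   Lebesgue (not Borel) measurability on (0, T). *)
Definition strongly_measurable T u : Prop :=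
  exists2 s : nat -> R -> V, (forall n, simple_fun (s n)) &
    ae_in T (fun t => s n t @[n --> \oo] --> u t).

Definition square_integrable T u : Prop :=
  strongly_measurable T u /\
  (\int[mu]_(t in `]0%R, T[) (`|u t| ^+ 2)%:E < +oo)%E.

Context (T : R).

(* Representatives are total functions on R; values outside (0, T) are
   irrelevant. *)
Record L2fun := MkL2fun {
  L2fun_val :> R -> V; L2fun_valP : square_integrable T L2fun_val }.

HB.instance Definition _ := gen_eqMixin L2fun.
HB.instance Definition _ := gen_choiceMixin L2fun.

Definition L2_eq (u v : L2fun) : bool := `[< ae_in T (fun t => u t = v t) >].

Let L2_eq_refl : reflexive L2_eq.
Proof. by move=> u; apply/asboolP; exact: aeW. Qed.

Let L2_eq_sym : symmetric L2_eq.
Proof.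
by move=> u v; apply/asboolP/asboolP; apply: filterS => t ->.
Qed.

Let L2_eq_trans : transitive L2_eq.
Proof.
move=> v u w /asboolP uv /asboolP vw; apply/asboolP.
by apply: filterS2 uv vw => t -> ->.
Qed.

Canonical L2_eq_equiv := EquivRel L2_eq L2_eq_refl L2_eq_sym L2_eq_trans.

Definition L2 : Type := {eq_quot L2_eq}%qT.
HB.instance Definition _ := Choice.on L2.
HB.instance Definition _ := EqQuotient.on L2.

Definition L2_repr (u : L2) : R -> V := (repr u : L2fun).
Coercion L2_repr : L2 >-> Funclass.

End Bochner.

Arguments strongly_measurable {R V} T u.
Arguments square_integrable {R V} T u.
Arguments L2 {R} V T.

(* In [\ae t \in(0, T), forall v, P] the exceptional null set does not depend
   on [v]. *)
Notation "'\ae' t '\in(0,' T ')' , P" := (ae_in T (fun t => P))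
  (at level 200, t name, T at level 99, P at level 200,
   format "'\ae'  t  '\in(0,' T ')' ,  P") : type_scope.

(* Main.v *)
(* For fixed t and w = (Su)(t) the inequality reads F(u, v) >= 0 for all v in K,
   where F(u, v) = <A(t,u) - f(t), v - u> + phi(w,u,v) - phi(w,u,u)
   + J^0(t, Mu; M(v - u)) satisfies F(u, v) + F(v, u) <= - m |u - v|^2 with
   m = m_A - alpha_phi - m_J |M|^2 > 0. Approximate solutions of finitely many of
   the Minty inequalities F(v_i, .) <= 0 come from a game-theoretic argument,
   reflexivity gives a common solution for all points v_i of a countable set D
   that is dense in K and in the graph of phi(0, u_0, .), and convexity along
   segments turns this into F(u, .) >= 0 on K. The solution u(t) is strongly
   measurable in t because smallness of sup_i F(v_i, d) controls |d - u(t)| and is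
   achieved by points of D. Finally u(t) depends Lipschitz continuously on w, so the
   history-dependent problem is a Volterra fixed point problem, solved by Picard
   iteration. *)

Require Import Defs.
From HB Require Import structures.
From mathcomp Require Import all_boot all_order all_algebra.
From mathcomp Require Import all_classical all_reals all_analysis.
From mathcomp Require Import measurable_realfun ring lra.
Set Implicit Arguments.
Unset Strict Implicit.
Unset Printing Implicit Defensive.
Import Order.TTheory GRing.Theory Num.Theory.
Import numFieldNormedType.Exports.
Local Open Scope classical_set_scope.
Local Open Scope ring_scope.

(** * The Hahn-Banach theorem and reflexive spaces *)

(** Two obstacles shape the proof. First, [phi w u] is only lower semicontinuous, so inequalities at
    the points of a dense subset of [K] do not pass to the other points. By [phi_ineq], however,
    [phi w u - phi 0 v0] is Lipschitz on [K] for every [w] and every [u] in [K]. Density in the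
    graph of the single function [phi 0 v0] is therefore enough, and one sequence [D] serves all
    times [t] and all [w]. Second, the solution at time [t] comes from a pointwise choice that
    carries no measurability. The Minty inequalities are for this reason treated with an error [e]:
    countably many of them define a gap function that is measurable in [t], and its near-minimizers
    among the points of [D] form simple functions converging to the solution. *)

Definition sublinear (R : realType) (E : lmodType R) (p : E -> R) : Prop :=
  (forall x y, p (x + y) <= p x + p y) /\
  (forall l x, 0 <= l -> p (l *: x) = l * p x).

Section HahnBanach.
Context (R : realType) (E : lmodType R).
Implicit Types (p q : E -> R) (x y v : E).

Lemma sublinear0 p : sublinear p -> p 0 = 0.
Proof. by move=> [_ /(_ 0 0 (lexx _))]; rewrite scale0r mul0r. Qed.

Lemma sublinear_geN p x : sublinear p -> - p (- x) <= p x.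
Proof.
move=> sp; have [sD _] := sp.
by have := sD x (- x); rewrite subrr sublinear0// -subr_ge0; lra.
Qed.

(** The [q i] need not be sublinear: it is enough that each sum [q i x + q j y] and each positive
    multiple is undercut by some member of the family. This covers translates of one functional,
    chains in Zorn's lemma and distances to a convex set. *)
Lemma inf_sublinear (I : Type) (i0 : I) (q : I -> E -> R) :
  (forall x, exists b, forall i, b <= q i x) ->
  (forall i j x y, exists k, q k (x + y) <= q i x + q j y) ->
  (forall i l x, 0 < l -> exists k, q k (l *: x) <= l * q i x) ->
  sublinear (fun x => inf (range (q ^~ x))).
Proof.
move=> qb qD qZ; set p := fun x => _.
have lb x : has_lbound (range (q ^~ x)).
  by have [b qb'] := qb x; exists b => _ [i _ <-]; exact: qb'.
have ple i x : p x <= q i x by apply: ge_inf => //; exists i.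
have pge c x : (forall i, c <= q i x) -> c <= p x.
  move=> cq; apply: lb_le_inf; first by exists (q i0 x), i0.
  by move=> _ [i _ <-]; exact: cq.
have pZ l x : 0 < l -> p (l *: x) <= l * p x.
  move=> l0; rewrite mulrC -ler_pdivrMr//; apply: pge => i.
  have [k /(le_trans (ple _ _))] := qZ i l x l0.
  by rewrite ler_pdivrMr// mulrC.
have pZE l x : 0 < l -> p (l *: x) = l * p x.
  move=> l0; apply/eqP; rewrite eq_le pZ//=.
  have := pZ l^-1 (l *: x); rewrite invr_gt0 l0 => /(_ erefl).
  rewrite scalerA mulVf ?gt_eqF// scale1r => h.
  by rewrite -ler_pdivlMl.
split=> [x y|l x].
  rewrite -lerBlDr; apply: (pge) => i; rewrite lerBlDr -lerBlDl.
  apply: (pge) => j; rewrite lerBlDl.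
  by have [k] := qD i j x y; exact/le_trans/ple.
rewrite le_eqVlt => /predU1P[<-|]; last exact: pZE.
rewrite scale0r mul0r; have := @pZE 2 0 ltac:(lra); rewrite scaler0; lra.
Qed.

(** [q x] is the infimum of [p (x + s v) - s p v] over [s >= 0]. A minimal [p] must coincide with
    it, so [p] is odd and hence linear. For any [p], a linear functional below [q] takes the value
    [p v] at [v]. *)
Lemma sublinear_push p v : sublinear p ->
  exists q, [/\ sublinear q, forall x, q x <= p x & q (- v) <= - p v].
Proof.
move=> sp; pose q (s : {s : R | 0 <= s}) x := p (x + sval s *: v) - sval s * p v.
have qlb x s : - p (- x) <= q s x.
  rewrite /q; have := sp.1 (x + sval s *: v) (- x).
  rewrite addrAC subrr add0r sp.2; last exact: (proj2_sig s).
  lra.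
have infq s x : inf (range (q ^~ x)) <= q s x.
  by apply: ge_inf; [exists (- p (- x)) => _ [j _ <-]|exists s].
exists (fun x => inf (range (q ^~ x))); split.
- apply: (inf_sublinear (exist _ 0 (lexx 0))).
  + by move=> x; exists (- p (- x)) => s; exact: qlb.
  + move=> [s s0] [t t0] x y; exists (exist _ (s + t) (addr_ge0 s0 t0)).
    rewrite /q /= scalerDl addrACA.
    have := sp.1 (x + s *: v) (y + t *: v); lra.
  + move=> [s s0] l x l0; exists (exist _ (l * s) (mulr_ge0 (ltW l0) s0)).
    by rewrite /q /= -scalerA -scalerDr sp.2 ?(ltW l0)// mulrBr mulrA.
- move=> x; apply: le_trans (infq (exist _ 0 (lexx 0)) x) _.
  by rewrite /q /= scale0r addr0 mul0r subr0.
- apply: le_trans (infq (exist _ 1 ler01) (- v)) _.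
  by rewrite /q /= scale1r addNr sublinear0// mul1r sub0r.
Qed.

(* A pointwise minimal sublinear functional is linear, so Zorn's lemma is
   applied to sublinear functionals instead of partial extensions. *)
Lemma hahn_banach p : sublinear p ->
  exists2 z : E -> R^o, linear z & forall x, z x <= p x.
Proof.
move=> sp.
pose P q := sublinear q /\ forall x, q x <= p x.
pose T := {q : E -> R | P q}.
(* The order is reversed, so that a maximal element is a minimal functional. *)
pose Rl (q r : T) := `[< forall x, sval r x <= sval q x >].
have [||||z0 zmin0] := @Zorn T Rl.
- by move=> q; apply/asboolP.
- move=> q r s /asboolP qr /asboolP rs; apply/asboolP => x.
  exact: le_trans (rs _) (qr _).
- move=> [q hq] [r hr] /asboolP /= qr /asboolP /= rq; apply: eq_exist.
  by apply/funext => x; apply/eqP; rewrite eq_le qr rq.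
- move=> A totA; have [[q0 Aq0]|A0] := pselect (A !=set0); last first.
    have pP : P p by [].
    exists (exist P p pP) => s As.
    by exfalso; apply: A0; exists s.
  pose I := {q : T | A q}; pose Q (i : I) := sval (sval i).
  have Qp (i : I) x : Q i x <= p x by rewrite /Q; case: (sval i) => q [].
  have Qs (i : I) : sublinear (Q i) by rewrite /Q; case: (sval i) => q [].
  have i0 : I by exists q0.
  have Qlb x (i : I) : - p (- x) <= Q i x.
    by apply: le_trans (sublinear_geN _ (Qs i)); rewrite lerN2.
  have sQ : sublinear (fun x => inf (range (Q ^~ x))).
    apply: (inf_sublinear i0).
    + by move=> x; exists (- p (- x)) => i; exact: Qlb.
    + move=> i j x y; have [/asboolP ij|/asboolP ji] := totA _ _ (proj2_sig i) (proj2_sig j).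
        exists j; apply: le_trans ((Qs j).1 _ _) _; rewrite lerD2r; exact: ij.
      exists i; apply: le_trans ((Qs i).1 _ _) _; rewrite lerD2l; exact: ji.
    + by move=> i l x l0; exists i; rewrite (Qs i).2// ltW.
  have infQ (i : I) x : inf (range (Q ^~ x)) <= Q i x.
    by apply: ge_inf; [exists (- p (- x)) => _ [j _ <-]|exists i].
  have QP : P (fun x => inf (range (Q ^~ x))).
    by split=> // x; exact: le_trans (infQ i0 x) (Qp i0 x).
  exists (exist P _ QP).
  by move=> s As; apply/asboolP => x; exact: (infQ (exist _ s As)).
- move: z0 zmin0 => [z [sz zp]] /= zmin.
  have zN v : z (- v) = - z v.
    have [q [sq qz qv]] := sublinear_push v sz.
    have qP : P q by split=> // x; exact: le_trans (qz x) (zp x).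
    have := zmin (exist P q qP).
    move=> /(_ (introT (asboolP _) qz)) /(congr1 sval) /(congr1 (@^~ (- v))) /= qE.
    move: qv; rewrite qE => zvN.
    by apply/eqP; rewrite eq_le zvN; have := sublinear_geN v sz; rewrite lerNl.
  exists z => // l x y.
  have zD a b : z (a + b) = z a + z b.
    apply/eqP; rewrite eq_le sz.1/=.
    have := sz.1 (a + b) (- b); rewrite addrK zN; lra.
  rewrite zD; congr (_ + _).
  have [l0|l0] := leP 0 l; first by rewrite sz.2.
  by rewrite -[l]opprK scaleNr zN sz.2 ?oppr_ge0 ?ltW// [RHS]mulNr.
Qed.

End HahnBanach.

Definition convex2 (R : realType) (E : lmodType R) (C : set E) : Prop :=
  forall x y (s : R), C x -> C y -> 0 <= s -> s <= 1 -> C ((1 - s) *: x + s *: y).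

Section Reflexive.
Context (R : realType).
Implicit Types V : normedModType R.

Lemma dual_of_bound V (z : V -> R^o) (c : R) : linear z ->
  (forall x, z x <= c * `|x|) -> exists g : dual V, forall x, g x = z x.
Proof.
move=> lz zc.
pose zl := HB.pack_for {linear V -> R^o} z (GRing.isLinear.Build R V R^o *:%R z lz).
have cz : continuous z.
  apply: (@bounded_linear_continuous _ _ _ zl); apply/linear_boundedP.
  exists c; split; [exact: num_real|move=> r /ltW rc x].
  have zN : z (- x) = - z x by exact: (linearN zl).
  have crx : c * `|x| <= r * `|x| by rewrite ler_wpM2r.
  rewrite ler_norml; apply/andP; split; last exact: le_trans (zc x) crx.
  by rewrite lerNl -zN; apply: le_trans (zc _) _; rewrite normrN.
have zP : z \in @is_blin R V R^o by apply/is_blinP.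
by exists (Blin zP).
Qed.

Lemma dual_norm_ge V (g : dual V) x : `|g x| <= `|g| * `|x|.
Proof. exact: opnormP. Qed.

Lemma dual_ge V (g : dual V) x : - (`|g| * `|x|) <= g x.
Proof. by have := dual_norm_ge g x; rewrite ler_norml => /andP[]. Qed.

Lemma dual_le V (g : dual V) x : g x <= `|g| * `|x|.
Proof. by have := dual_norm_ge g x; rewrite ler_norml => /andP[]. Qed.

(** The functional is a linear minorant of the infimum of [|x + l (c - v)| - l r] over [l >= 0] and
    [c] in [C]: [l = 0] bounds it by the norm, and [l = 1] at [x = v - c] gives the gap [r].
    Convexity of [C] merges the pairs [(l, c)] and [(m, e)] into one with coefficient [l + m]. *)
Lemma separation V (C : set V) v r : 0 < r -> convex2 C -> C !=set0 ->
  (forall c, C c -> r <= `|c - v|) ->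
  exists g : dual V, forall c, C c -> g v + r <= g c.
Proof.
move=> r0 cC [c0 Cc0] Cr.
pose I := ({l : R | 0 <= l} * {c : V | C c})%type.
pose q (i : I) x := `|x + sval i.1 *: (sval i.2 - v)| - sval i.1 * r.
pose i0 : I := (exist _ 0 (lexx 0), exist _ c0 Cc0).
have qlb x i : - `|x| <= q i x.
  move: i => [[l l0] [c Cc]]; rewrite /q /=.
  have := ler_normB (x + l *: (c - v)) x.
  rewrite addrAC subrr add0r normrZ ger0_norm//.
  have := ler_wpM2l l0 (Cr _ Cc); lra.
have sq : sublinear (fun x => inf (range (q ^~ x))).
  apply: (inf_sublinear i0).
  - by move=> x; exists (- `|x|) => i; exact: qlb.
  - move=> [[l l0] [c Cc]] [[m m0] [e Ce]] x y.
    have [lm|lm] := eqVneq (l + m) 0.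
      have [l00 m00] : l = 0 /\ m = 0 by split; lra.
      exists (exist _ 0 (lexx 0), exist _ c Cc); rewrite /q /= l00 m00.
      by rewrite !scale0r !addr0 !mul0r !subr0; exact: ler_normD.
    have lm0 : 0 < l + m by rewrite lt_def lm addr_ge0.
    have Cd : C ((1 - m / (l + m)) *: c + (m / (l + m)) *: e).
      apply: cC => //; first by rewrite divr_ge0// addr_ge0.
      by rewrite ler_pdivrMr// mul1r lerDr.
    exists (exist _ (l + m) (addr_ge0 l0 m0), exist _ _ Cd); rewrite /q /=.
    have -> : (l + m) *: ((1 - m / (l + m)) *: c + (m / (l + m)) *: e - v) =
        l *: (c - v) + m *: (e - v).
      rewrite !scalerBr scalerDr !scalerA mulrBr mulr1 mulrCA divff// mulr1.
      by rewrite addrK scalerDl opprD addrACA.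
    rewrite addrACA; have := ler_normD (x + l *: (c - v)) (y + m *: (e - v)).
    lra.
  - move=> [[l l0] c] k x k0; exists (exist _ (k * l) (mulr_ge0 (ltW k0) l0), c).
    rewrite /q /= -scalerA -scalerDr normrZ gtr0_norm// -mulrA -mulrBr.
    exact: lexx.
have infq i x : inf (range (q ^~ x)) <= q i x.
  by apply: ge_inf; [exists (- `|x|) => _ [j _ <-]|exists i].
have [z lz zp] := hahn_banach sq.
have zq i x : z x <= q i x by exact: le_trans (zp x) (infq i x).
have [|g gz] := @dual_of_bound V z 1 lz.
  move=> x; apply: le_trans (zq i0 x) _.
  by rewrite /q /= scale0r addr0 mul0r subr0 mul1r.
exists g => c Cc.
have := zq (exist _ 1 ler01, exist _ c Cc) (- (c - v)).
rewrite /q /= scale1r addNr normr0 mul1r sub0r -gz linearN linearB.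
rewrite lerNr opprK => h; rewrite -lerBrDl; exact: h.
Qed.

(* The limits of <z, x_n> along an ultrafilter define an element of the bidual,
   which reflexivity turns into a weak limit of (x_n). *)
Lemma reflexive_nested V (C : nat -> set V) (B : R) : reflexive_space V ->
  (forall n, C n !=set0) -> (forall n, closed (C n)) ->
  (forall n, convex2 (C n)) -> (forall n m, (n <= m)%N -> C m `<=` C n) ->
  (forall x, C 0%N x -> `|x| <= B) -> exists v, forall n, C n v.
Proof.
move=> reflV C0 Ccl Ccvx Cdec CB.
have [x Cx] := choice C0.
have B0 : 0 <= B by apply: le_trans (CB _ (Cx 0%N)).
have xB n : `|x n| <= B by apply: CB; exact: (Cdec 0%N n) (Cx n).
have [G [UG sG]] := ultraFilterLemma (eventually_filter).
have PG : ProperFilter G by exact: ultra_proper.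
have zcvg (z : dual V) : exists l : R, (z (x n) : R) @[n --> G] --> l.
  pose zx n : R := z (x n).
  have [|l [_ cl]] := @segment_compact R (- (`|z| * B)) (`|z| * B) (zx @ G) _.
    apply: (@filterE nat G) => n; rewrite /= in_itv /= -ler_norml.
    have zxn : `|z (x n)| <= `|z| * B.
      by apply: le_trans (dual_norm_ge z _) _; rewrite ler_wpM2l.
    exact: zxn.
  (* Along an ultrafilter a cluster point is a limit. *)
  exists l => U lU; have [//|GU] := in_ultra_setVsetC (zx @^-1` U) UG.
  by have [y [/= yU]] := cl (~` U) U GU lU.
have [F FP] := choice zcvg.
have lF : linear (F : dual V -> R^o).
  move=> a y z.
  have /cvg_unique : (fun n => (a *: y + z) (x n) : R) @ G --> F (a *: y + z).
    exact: FP.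
  apply => //; apply: cvgD; last exact: FP.
  by apply: cvgZl_tmp; exact: FP.
have [|F' F'E] := @dual_of_bound (dual V) F B lF.
  move=> z; apply: (cvgr_to_le (FP z)); apply: nearW => n.
  rewrite mulrC; apply: le_trans (dual_le z _) _.
  by rewrite ler_wpM2l.
have [v vP] := reflV F'; exists v => n; apply: contrapT => nCv.
(* If [v] were outside the closed set [C n], some [g] would separate it with a margin [r]; the
   margin survives in the limit and gives [g v + r <= F g = g v]. *)
have /nbhs_ballP[r /= r0 vr] : nbhs v (~` C n).
  by apply: open_nbhs_nbhs; split => //; exact: closed_openC.
have [|g gP] := separation r0 (Ccvx n) (C0 n) (v := v).
  move=> c Cc; rewrite leNgt; apply/negP => cr.
  by apply: (vr c) Cc; rewrite -ball_normE /ball_ /= distrC.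
have : g v + r <= F g.
  apply: (cvgr_to_ge (FP g)); apply: sG; exists n => // m /= nm.
  exact/gP/(Cdec n m nm).
rewrite -F'E vP; lra.
Qed.

End Reflexive.

(** * Strongly monotone equilibrium problems *)

Lemma sqr_norm_convex (R : realType) (V : normedModType R) (x y : V) (s : R) :
  0 <= s -> s <= 1 ->
  `|(1 - s) *: x + s *: y| ^+ 2 <= (1 - s) * `|x| ^+ 2 + s * `|y| ^+ 2.
Proof.
move=> s0 s1; apply: (@le_trans _ _ (((1 - s) * `|x| + s * `|y|) ^+ 2)).
  rewrite lerXn2r ?nnegrE ?addr_ge0 ?mulr_ge0 ?subr_ge0//.
  apply: le_trans (ler_normD _ _) _.
  by rewrite !normrZ (ger0_norm s0) ger0_norm ?subr_ge0.
rewrite -subr_ge0 (_ : _ - _ = s * (1 - s) * (`|x| - `|y|) ^+ 2); last by ring.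
by rewrite mulr_ge0 ?sqr_ge0// mulr_ge0// subr_ge0.
Qed.

Definition lsc_on (R : realType) (V : normedModType R) (K : set V) (g : V -> R) :=
  forall u (e : R), K u -> 0 < e -> exists2 d : R, 0 < d &
    forall v, K v -> `|v - u| < d -> g u - e <= g v.

Definition convex2_fun (R : realType) (V : lmodType R) (K : set V) (g : V -> R) :=
  forall u v (s : R), K u -> K v -> 0 <= s -> s <= 1 ->
    g ((1 - s) *: u + s *: v) <= (1 - s) * g u + s * g v.

Lemma segmentBl (R : realType) (V : lmodType R) (u v : V) (s : R) :
  (1 - s) *: u + s *: v - u = s *: (v - u).
Proof. by rewrite scalerBl scale1r scalerBr addrAC [u - _]addrC addrK addrC. Qed.

Lemma segmentBr (R : realType) (V : lmodType R) (u v : V) (s : R) :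
  (1 - s) *: u + s *: v - v = (1 - s) *: (u - v).
Proof. by rewrite scalerBr (scalerBl 1 s v) scale1r opprB addrA. Qed.

(** Semicontinuity gives the bound [g u0 - 1] on a ball of radius [d]. For [u] outside it, apply
    this bound at the point of the segment at distance [d / 2] from [u0]; convexity turns it into a
    bound of slope [2 / d] at [u]. *)
Lemma convex_lsc_minorant (R : realType) (V : normedModType R) (K : set V)
    (g : V -> R) u0 : convex2 K -> convex2_fun K g -> lsc_on K g -> K u0 ->
  exists2 c, 0 <= c & forall u, K u -> g u0 - 1 - c * `|u - u0| <= g u.
Proof.
move=> Kcvx gcvx glsc Ku0.
have [d d0 gd] := glsc u0 1 Ku0 ltr01.
exists (2 / d) => [|u Ku]; first by rewrite divr_ge0// ltW.
have [ud|ud] := ltP `|u - u0| d.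
  apply: le_trans (gd u Ku ud); rewrite gerBl.
  by rewrite mulr_ge0// divr_ge0// ltW.
have u0' : 0 < `|u - u0| by exact: lt_le_trans ud.
set s := d / (2 * `|u - u0|).
have s0 : 0 < s by rewrite divr_gt0// mulr_gt0.
have s1 : s <= 1 by rewrite ler_pdivrMr ?mulr_gt0// mul1r; lra.
have su : s * `|u - u0| = d / 2 by rewrite /s; field; rewrite gt_eqF.
have := gd _ (Kcvx u0 u s Ku0 Ku (ltW s0) s1).
rewrite segmentBl normrZ gtr0_norm// su => /(_ ltac:(lra)) h1.
have h2 := gcvx u0 u s Ku0 Ku (ltW s0) s1.
have h3 : s * (g u0 - g u) <= 1 by lra.
have h4 : g u0 - g u <= s^-1 by rewrite -[s^-1]mul1r ler_pdivlMr// mulrC.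
have -> : 2 / d * `|u - u0| = s^-1 by rewrite /s; field; rewrite !gt_eqF.
by lra.
Qed.

(** Averaging the sums over [j] with the same weights symmetrizes [G], so they cannot all be
    positive. This elementary argument takes the place of a minimax or fixed point theorem. *)
Lemma skew_game (R : realType) (n : nat) (G : 'I_n -> 'I_n -> R) (p : 'I_n -> R) :
  (forall i j, G i j + G j i <= 0) -> (forall i, 0 <= p i) ->
  (exists i, 0 < p i) -> exists j, \sum_i p i * G i j <= 0.
Proof.
move=> GS p0 [i0 pi0]; apply: contrapT => /forallNP h.
have {}h j : 0 < \sum_i p i * G i j by rewrite ltNge; apply/negP.
have : 0 < \sum_j p j * \sum_i p i * G i j.
  rewrite (bigD1 i0)//= ltr_pwDl//; first by rewrite mulr_gt0.
  by apply: sumr_ge0 => j _; rewrite mulr_ge0// ltW.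
have -> : \sum_j p j * \sum_i p i * G i j = \sum_j \sum_i p j * (p i * G i j).
  by apply: eq_bigr => j _; rewrite mulr_sumr.
set S := \sum_j _; have : S + S <= 0.
  rewrite {2}/S exchange_big -big_split; apply: sumr_le0 => j _.
  rewrite /= -big_split; apply: sumr_le0 => i _ /=.
  rewrite mulrCA -!mulrDr mulr_ge0_le0// mulr_ge0_le0//.
lra.
Qed.

Section Equilibrium.
Context (R : realType) (V : normedModType R).
Implicit Types (K : set V) (F : V -> V -> R) (psi : V -> R) (u v d : V).

(** [psi] carries the part of [F v] that is merely lower semicontinuous. The Lipschitz constant of
    the rest may grow linearly in [v], which strong monotonicity will absorb. *)
Record bifunction K psi (m : R) F : Prop := {
  bif_diag : forall u, K u -> F u u = 0;
  bif_monotone : forall u v, K u -> K v -> F u v + F v u <= - (m * `|u - v| ^+ 2);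
  bif_convex : forall u, K u -> convex2_fun K (F u);
  bif_lip : exists2 C, 0 <= C & forall v d e, K v -> K d -> K e ->
    F v d - F v e <= C * (1 + `|v|) * `|d - e| + (psi d - psi e);
  bif_usc : forall v, K v -> lsc_on K (fun u => - F u v) }.

Context (K : set V) (psi : V -> R) (m : R) (F : V -> V -> R).
Hypotheses (m_gt0 : 0 < m) (Kcvx : convex2 K) (FP : bifunction K psi m F).

Lemma bif_quad_convex v : K v ->
  convex2_fun K (fun d => F v d + m / 2 * `|d - v| ^+ 2).
Proof.
move=> Kv d d' s Kd Kd' s0 s1.
have := bif_convex FP Kv Kd Kd' s0 s1.
have := sqr_norm_convex (d - v) (d' - v) s0 s1.
have -> : (1 - s) *: (d - v) + s *: (d' - v) = (1 - s) *: d + s *: d' - v.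
  by rewrite !scalerBr addrACA -opprD -scalerDl subrK scale1r.
move=> /(ler_wpM2l (ltW (divr_gt0 m_gt0 (ltr0n _ 2)))); lra.
Qed.

(* Frank-Wolfe steps towards one of the points [v i] make the sum of the squares
   of the positive parts of the [F (v i) d + m/2 |d - v i|^2] decay like 1/k. *)
Lemma finite_minty (n : nat) (v : 'I_n.+1 -> V) (e : R) : (forall i, K (v i)) ->
  0 < e -> exists2 d, K d & forall i, F (v i) d + m / 2 * `|d - v i| ^+ 2 <= e.
Proof.
move=> Kv e0; pose g i d := F (v i) d + m / 2 * `|d - v i| ^+ 2.
pose G i j := g i (v j); pose C := \sum_i \sum_j G i j ^+ 2.
have gcvx i : convex2_fun K (g i) by exact/bif_quad_convex/Kv.
have GS i j : G i j + G j i <= 0.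
  rewrite /G /g; have := bif_monotone FP (Kv i) (Kv j).
  by rewrite (distrC (v j)); lra.
have C0 : 0 <= C by apply: sumr_ge0 => i _; apply: sumr_ge0 => j _; exact: sqr_ge0.
have GC j : \sum_i G i j ^+ 2 <= C.
  rewrite /C; apply: ler_sum => i _; rewrite (bigD1 j)//= lerDl.
  by apply: sumr_ge0 => k _; exact: sqr_ge0.
pose P d := \sum_i Num.max (g i d) 0 ^+ 2.
have posq (a b : R) : a <= b -> Num.max a 0 ^+ 2 <= b ^+ 2.
  move=> ab; have [a0|a0] := leP a 0; first by rewrite expr0n sqr_ge0.
  by rewrite lerXn2r// nnegrE; lra.
have step k : exists2 d, K d & P d <= C / k.+1%:R.
  elim: k => [|k [d Kd Pd]].
    exists (v ord0) => //; rewrite divr1; apply: le_trans (GC ord0).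
    by apply: ler_sum => i _; exact: posq.
  have [[i pi]|p0] := pselect (exists i, 0 < Num.max (g i d) 0); last first.
    exists d => //; rewrite /P big1 ?divr_ge0// => i _.
    have : ~ 0 < Num.max (g i d) 0 by move=> h; apply: p0; exists i.
    by rewrite lt_max ltxx orbF => /negP; rewrite -leNgt => /max_idPr ->; rewrite expr0n.
  (* Weighting by the positive parts makes the cross term of the expanded squares nonpositive. With
     step [1 / (k + 2)] the bounds of the two other terms add up to [C / (k + 2)]. *)
  have [||j pj] := skew_game GS (p := fun i => Num.max (g i d) 0).
  - by move=> l; rewrite le_max lexx orbT.
  - by exists i.
  set s : R := k.+2%:R^-1.
  have k0 : 0 < k.+1%:R :> R by rewrite ltr0n.
  have k1 : k.+2%:R = k.+1%:R + 1 :> R by rewrite -natr1.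
  have s0 : 0 <= s by rewrite invr_ge0.
  have s1 : s <= 1 by rewrite invf_le1 ?ler1n ?ltr0n.
  exists ((1 - s) *: d + s *: v j); first exact: Kcvx.
  apply: (@le_trans _ _ (\sum_i ((1 - s) * Num.max (g i d) 0 + s * G i j) ^+ 2)).
    apply: ler_sum => l _; apply: posq.
    apply: le_trans (gcvx _ _ _ _ Kd (Kv j) s0 s1) _.
    by rewrite lerD2r ler_wpM2l ?subr_ge0// le_max lexx.
  have -> : \sum_i ((1 - s) * Num.max (g i d) 0 + s * G i j) ^+ 2 =
     (1 - s) ^+ 2 * P d + 2 * s * (1 - s) * (\sum_i Num.max (g i d) 0 * G i j)
     + s ^+ 2 * \sum_i G i j ^+ 2.
    rewrite /P !mulr_sumr -!big_split; apply: eq_bigr => l _ /=; ring.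
  have h1 : 2 * s * (1 - s) * (\sum_i Num.max (g i d) 0 * G i j) <= 0.
    by rewrite mulr_ge0_le0// !mulr_ge0// subr_ge0.
  have h2 : s ^+ 2 * (\sum_i G i j ^+ 2) <= s ^+ 2 * C by rewrite ler_wpM2l ?sqr_ge0.
  have h3 : (1 - s) ^+ 2 * P d <= (1 - s) ^+ 2 * (C / k.+1%:R).
    by rewrite ler_wpM2l ?sqr_ge0.
  have h4 : (1 - s) ^+ 2 * (C / k.+1%:R) + s ^+ 2 * C = C * s.
    rewrite /s k1; move: (k.+1%:R) k0 => a a0; field.
    by rewrite !gt_eqF// addr_gt0.
  by rewrite -h4; apply: le_trans (lerD (lerD h3 h1) h2) _; rewrite addr0.
have [d Kd Pd] := step (Num.bound (C / e ^+ 2)).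
exists d => // i; rewrite -/(g i d).
have h : Num.max (g i d) 0 ^+ 2 <= e ^+ 2.
  apply: (@le_trans _ _ (P d)).
    rewrite /P (bigD1 i)//= lerDl; apply: sumr_ge0 => k _; exact: sqr_ge0.
  apply: le_trans Pd _; rewrite ler_pdivrMr ?ltr0n// mulrC -ler_pdivrMr ?exprn_gt0//.
  apply/ltW; apply: lt_le_trans (archi_boundP _) _; first by rewrite divr_ge0 ?sqr_ge0.
  by rewrite ler_nat.
apply: (@le_trans _ _ (Num.max (g i d) 0)); first by rewrite le_max lexx.
by rewrite -(@ler_pXn2r _ 2)// nnegrE; [rewrite le_max lexx orbT|exact: ltW].
Qed.

(** Only the upper bound on [psi (D i)] is required: [bif_lip] is used with [D i] in the place of
    [d], where [psi] enters with a positive sign. *)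
Definition graph_dense (D : nat -> V) := (forall i, K (D i)) /\
  forall u (e : R), K u -> 0 < e -> exists i, `|D i - u| < e /\ psi (D i) < psi u + e.

Context (D : nat -> V) (Ddense : graph_dense D).

(** For [D i] near the point [vs] of the segment, [0 = F (D i) (D i)] is at most [F (D i) vs] up to
    a small error; convexity splits this into [(1 - s) F (D i) d + s F (D i) v], and semicontinuity
    replaces the last [D i] by [vs]. With [e = 0] this is Minty's lemma; the error term is what
    measurability relies on. *)
Lemma minty_stampacchia d (e : R) v (s : R) : K d -> 0 <= e -> (forall i, F (D i) d <= e) ->
  K v -> 0 < s -> s <= 1 -> - ((1 - s) * e) <= s * F ((1 - s) *: d + s *: v) v.
Proof.
move=> Kd e0 de Kv s0 s1; have [KD Dd] := Ddense.
set vs := (1 - s) *: d + s *: v; have Kvs : K vs by exact: Kcvx (ltW s0) s1.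
have [C C0 CP] := bif_lip FP.
apply/ler_addgt0Pr => eta eta0; pose C1 := C * (2 + `|vs|).
have C10 : 0 <= C1 by rewrite mulr_ge0.
have [r r0 rP] := bif_usc FP Kv Kvs (divr_gt0 eta0 (ltr0n _ 3)).
(* Semicontinuity, the Lipschitz part and [psi] cost [eta / 3] each; distance below 1 keeps the norm
   of [D i] under that of [vs] plus 1. *)
pose e1 := Num.min (Num.min r 1) (Num.min (eta / 3 / (C1 + 1)) (eta / 3)).
have C11 : 0 < C1 + 1 by lra.
have e10 : 0 < e1 by rewrite /e1 !lt_min r0 ltr01 !divr_gt0.
have [i [iv ip]] := Dd vs e1 Kvs e10.
move: iv; rewrite /e1 !lt_min => /andP[/andP[ir i1] /andP[iC i3]].
have ip3 : psi (D i) < psi vs + eta / 3.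
  by apply: lt_le_trans ip _; rewrite lerD2l /e1 !ge_min lexx !orbT.
have /= h1 := rP _ (KD i) ir.
have h2 := CP _ _ _ (KD i) (KD i) Kvs; rewrite (bif_diag FP (KD i)) in h2.
have h3 := bif_convex FP (KD i) Kd Kv (ltW s0) s1; rewrite -/vs in h3.
have h4 : C * (1 + `|D i|) * `|D i - vs| <= eta / 3.
  apply: (@le_trans _ _ (C1 * `|D i - vs|)).
    rewrite ler_wpM2r// ler_wpM2l//.
    by have := ler_normD (D i - vs) vs; rewrite subrK; lra.
  apply: (@le_trans _ _ ((C1 + 1) * `|D i - vs|)); first by rewrite ler_wpM2r//; lra.
  by rewrite mulrC -ler_pdivlMr// ltW.
have h5 : (1 - s) * F (D i) d <= (1 - s) * e by rewrite ler_wpM2l// subr_ge0.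
have h6 : s * F (D i) v <= s * (F vs v + eta / 3) by apply: ler_wpM2l; [exact: ltW|lra].
have h7 : s * (eta / 3) <= eta / 3 by rewrite ler_piMl//; lra.
lra.
Qed.

Definition equilibrium u := K u /\ forall v, K v -> 0 <= F u v.

(** Let [s] tend to 0 in the preceding lemma, by upper semicontinuity of [F] in its first
    argument. *)
Lemma equilibrium_of_minty u : K u -> (forall i, F (D i) u <= 0) -> equilibrium u.
Proof.
move=> Ku uD; split=> // v Kv.
have h (s : R) : 0 < s -> s <= 1 -> 0 <= F ((1 - s) *: u + s *: v) v.
  move=> s0 s1; have := minty_stampacchia Ku (lexx 0) uD Kv s0 s1.
  by rewrite mulr0 oppr0 pmulr_rge0.
apply/ler_addgt0Pr => eta eta0; have [r r0 rP] := bif_usc FP Kv Ku eta0.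
pose s := Num.min 1 (r / (2 * (`|v - u| + 1))).
have vu1 : 0 < `|v - u| + 1 by rewrite ltr_wpDl.
have s0 : 0 < s by rewrite lt_min ltr01 divr_gt0// mulr_gt0.
have s1 : s <= 1 by rewrite ge_min lexx.
have /= := rP _ (Kcvx Ku Kv (ltW s0) s1); rewrite segmentBl normrZ gtr0_norm//.
have sr : s * (2 * (`|v - u| + 1)) <= r.
  by rewrite -ler_pdivlMr ?mulr_gt0// ge_min lexx orbT.
have := h s s0 s1; have : 0 <= s * `|v - u| by rewrite mulr_ge0// ltW.
move=> ? ? /(_ ltac:(lra)); lra.
Qed.

(** Apply monotonicity to [u] and the midpoint [w] of [d] and [u]: [F u w >= 0] since [u] is an
    equilibrium, and [F w u >= - e] by [minty_stampacchia] with [s = 1 / 2]. Halving the distance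
    produces the factor 4. *)
Lemma minty_gap u d (e : R) : equilibrium u -> K d -> 0 <= e ->
  (forall i, F (D i) d <= e) -> m * `|d - u| ^+ 2 <= 4 * e.
Proof.
move=> [Ku uP] Kd e0 de; have s0 : 0 < 2^-1 :> R by lra.
have s1 : 2^-1 <= 1 :> R by lra.
have := minty_stampacchia Kd e0 de Ku s0 s1; set w := _ *: d + _ => h1.
have Kw : K w by exact: Kcvx (ltW s0) s1.
have h2 := bif_monotone FP Ku Kw; have h3 := uP w Kw.
have : `|u - w| ^+ 2 = `|d - u| ^+ 2 / 4.
  rewrite distrC segmentBr normrZ exprMn (_ : `|1 - 2^-1| = 2^-1 :> R).
    by field.
  by rewrite ger0_norm; lra.
move=> h4; rewrite h4 in h2; lra.
Qed.

(** Take [D j] close to [u] in the graph of [psi]. The error in [F (D i) (D j)] grows with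
    [|D i - u|], but [F (D i) u <= - m |D i - u|^2] compensates it uniformly in [i]. *)
Lemma minty_gap_inf u (e : R) : equilibrium u -> 0 < e -> exists j, forall i, F (D i) (D j) <= e.
Proof.
move=> [Ku uP] e0; have [KD Dd] := Ddense; have [C C0 CP] := bif_lip FP.
pose C1 := C * (1 + `|u|).
have C10 : 0 <= C1 by rewrite mulr_ge0.
pose r := Num.min (e / 4 / (C1 + 1)) (Num.min (e / 4) (Num.min 1 (m * (e / 4) / (C ^+ 2 + 1)))).
have C11 : 0 < C1 + 1 by lra.
have C2 : 0 < C ^+ 2 + 1 by rewrite ltr_wpDl ?sqr_ge0.
have r0 : 0 < r by rewrite !lt_min ltr01 !divr_gt0// mulr_gt0// divr_gt0.
have [j [ju jp]] := Dd u r Ku r0; exists j => i.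
have h1 := CP _ _ _ (KD i) (KD j) Ku.
have h2 := bif_monotone FP (KD i) Ku.
have h3 := uP _ (KD i).
have jp4 : psi (D j) < psi u + e / 4.
  by apply: lt_le_trans jp _; rewrite lerD2l /r !ge_min lexx !orbT.
move: ju; rewrite /r !lt_min => /andP[jC /andP[_ /andP[j1 jm]]].
set x := `|D j - u| in h1 jC j1 jm *; set y := `|D i - u| in h2 *.
have x0 : 0 <= x by exact: normr_ge0.
have y0 : 0 <= y by exact: normr_ge0.
have h4 : C1 * x <= e / 4.
  apply: (@le_trans _ _ ((C1 + 1) * x)); first by rewrite ler_wpM2r//; lra.
  by rewrite mulrC -ler_pdivlMr// ltW.
have h5 : C * (1 + `|D i|) * x <= C1 * x + C * y * x.
  rewrite -mulrDl ler_wpM2r// /C1 -mulrDr ler_wpM2l//.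
  by have := ler_normD (D i - u) u; rewrite subrK -/y; lra.
have h6 : C * y * x <= m * y ^+ 2 + e / 4.
  have h7 : C ^+ 2 * x ^+ 2 <= m * (e / 4).
    apply: (@le_trans _ _ ((C ^+ 2 + 1) * x)).
      have : x ^+ 2 <= x by rewrite expr2 ler_piMl// ltW.
      by move=> /(ler_wpM2l (sqr_ge0 C)); lra.
    by rewrite mulrC -ler_pdivlMr// ltW.
  (* Completing the square in [y]; the remainder is nonnegative by the bound
     [m * (e / 4) / (C ^+ 2 + 1)] built into [r]. *)
  have h8 : 0 <= 4 * m * (m * y ^+ 2 + e / 4 - C * y * x).
    have -> : 4 * m * (m * y ^+ 2 + e / 4 - C * y * x) =
      (2 * m * y - C * x) ^+ 2 + (4 * (m * (e / 4)) - C ^+ 2 * x ^+ 2) by field.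
    by rewrite addr_ge0 ?sqr_ge0// subr_ge0; have := mulr_ge0 (ltW m_gt0) (ltW e0); lra.
  by move: h8; rewrite pmulr_rge0 ?subr_ge0// mulr_gt0.
lra.
Qed.

Lemma equilibrium_exists : reflexive_space V -> closed K ->
  convex2_fun K psi -> lsc_on K psi -> exists u, equilibrium u.
Proof.
move=> reflV Kcl psicvx psilsc; have [KD Dd] := Ddense.
have [C C0 CP] := bif_lip FP.
pose g i d := F (D i) d + m / 2 * `|d - D i| ^+ 2.
pose S n := [set d | K d /\ forall i, (i <= n)%N -> g i d <= n.+1%:R^-1].
have gcvx i : convex2_fun K (g i) by exact/bif_quad_convex/KD.
have glsc i : lsc_on K (g i).
  move=> u e Ku e0; pose c := C * (1 + `|D i|) + m * `|u - D i|.
  have c0 : 0 <= c by rewrite addr_ge0// mulr_ge0// ltW.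
  have c1 : 0 < c + 1 by lra.
  have [r r0 rP] := psilsc u (e / 2) Ku ltac:(lra).
  exists (Num.min r (e / 2 / (c + 1))); first by rewrite lt_min r0 !divr_gt0.
  move=> v Kv; rewrite lt_min => /andP[/rP -/(_ Kv) h1 h2].
  have h3 := CP _ _ _ (KD i) Ku Kv; rewrite (distrC u) in h3.
  have h4 : c * `|v - u| <= e / 2.
    apply: (@le_trans _ _ ((c + 1) * `|v - u|)); first by rewrite ler_wpM2r//; lra.
    by rewrite mulrC -ler_pdivlMr// ltW.
  have h5 : `|u - D i| ^+ 2 - `|v - D i| ^+ 2 <= 2 * (`|u - D i| * `|v - u|).
    have h6 : `|u - D i| - `|v - D i| <= `|v - u|.
      by have := ler_normD (u - v) (v - D i); rewrite addrA subrK (distrC u v); lra.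
    have := ler_wpM2l (normr_ge0 (u - D i)) h6.
    have := sqr_ge0 (`|u - D i| - `|v - D i|); lra.
  have := ler_wpM2l (ltW (divr_gt0 m_gt0 (ltr0n _ 2))) h5.
  rewrite /g; move: h4; rewrite /c; lra.
have SC n m' : (n <= m')%N -> S m' `<=` S n.
  move=> nm d [Kd gd]; split=> // i ni; apply: le_trans (gd i (leq_trans ni nm)) _.
  by rewrite lef_pV2 ?posrE ?ltr0n// ler_nat.
have [c c0 cP] := convex_lsc_minorant Kcvx psicvx psilsc (KD 0%N).
pose C1 := C * (1 + `|D 0%N|) + c.
have C10 : 0 <= C1 by rewrite addr_ge0// mulr_ge0.
have [|||||u uS] := @reflexive_nested _ _ S (2 / m * (2 + C1) + 1 + `|D 0%N|) reflV.
- move=> n; have [] := @finite_minty n (fun i => D i) n.+1%:R^-1.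
  + by move=> i; exact: KD.
  + by rewrite invr_gt0 ltr0n.
  + move=> d Kd dP; exists d; split=> // i ni.
    by have := dP (Ordinal (ni : (i < n.+1)%N)).
- move=> n d; rewrite /closure /= => cld; split.
    by apply: Kcl => B /cld[x [[Kx _] Bx]]; exists x.
  have Kd : K d by apply: Kcl => B /cld[x [[Kx _] Bx]]; exists x.
  move=> i ni; apply/ler_addgt0Pr => e e0; have [r r0 rP] := glsc i d e Kd e0.
  have [|x [[Kx gx] xd]] := cld (ball d r); first exact: nbhsx_ballx.
  have := rP x Kx; move: xd; rewrite -ball_normE /ball_ /= distrC => xd /(_ xd).
  by have := gx i ni; rewrite lerBlDr => h1 h2; exact: le_trans h2 (lerD h1 _).
- move=> n x y s [Kx gx] [Ky gy] s0 s1; split; first exact: Kcvx.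
  move=> i ni; apply: le_trans (gcvx _ _ _ _ Kx Ky s0 s1) _.
  move: (gx i ni) (gy i ni); set r := n.+1%:R^-1 => gxi gyi.
  rewrite (_ : r = (1 - s) * r + s * r); last by ring.
  by rewrite lerD// ler_wpM2l// subr_ge0.
- exact: SC.
- move=> d [Kd /(_ 0%N (leqnn _))]; rewrite /g invr1 => gd.
  have h1 := CP _ _ _ (KD 0%N) (KD 0%N) Kd; rewrite (bif_diag FP (KD 0%N)) (distrC (D 0%N)) in h1.
  have h2 := cP d Kd.
  set r := `|d - D 0%N| in gd h1 h2.
  (* One unit of the constant 2 is the level of [S 0], the other comes from the minorant of
     [psi]. *)
  have h3 : m / 2 * r ^+ 2 <= 2 + C1 * r by rewrite /C1; lra.
  have : `|d| <= r + `|D 0%N| by rewrite -{1}(subrK (D 0%N) d); exact: ler_normD.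
  suff : r <= 2 / m * (2 + C1) + 1 by lra.
  rewrite leNgt; apply/negP => rB.
  have B0 : 0 <= 2 / m * (2 + C1) by rewrite mulr_ge0 ?divr_ge0 ?(ltW m_gt0)//; lra.
  have r1 : 1 < r by lra.
  have h4 : 2 + C1 < m / 2 * r.
    have : m / 2 * (2 / m * (2 + C1) + 1) < m / 2 * r by rewrite ltr_pM2l ?divr_gt0.
    have -> : m / 2 * (2 / m * (2 + C1) + 1) = 2 + C1 + m / 2.
      by field; rewrite gt_eqF.
    by apply: lt_trans; rewrite ltrDl divr_gt0.
  have := ltr_pM2l (lt_trans ltr01 r1) (2 + C1) (m / 2 * r); rewrite h4; lra.
exists u; apply: equilibrium_of_minty; first by have [] := uS 0%N.
move=> i; apply/ler_addgt0Pr => e e0; rewrite add0r.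
pose n := maxn i (Num.bound e^-1).
have [_ /(_ i (leq_maxl _ _))] := uS n; rewrite /g.
have : n.+1%:R^-1 <= e.
  rewrite -[e]invrK lef_pV2 ?posrE ?ltr0n ?invr_gt0//.
  apply/ltW; apply: lt_le_trans (archi_boundP _) _; first by rewrite invr_ge0 ltW.
  by rewrite ler_nat leqW// leq_maxr.
have : 0 <= m / 2 * `|u - D i| ^+ 2 by rewrite mulr_ge0 ?sqr_ge0// divr_ge0 ?(ltW m_gt0).
by move=> h0 h1 h2; apply: le_trans h1; apply: le_trans h2; rewrite lerDl.
Qed.

End Equilibrium.

(** * The Clarke directional derivative *)

Section Clarke.
Context (R : realType) (X : normedModType R).
Implicit Types (h : X -> R) (x y v w : X).

Definition clarke h x v : R := fine (clarke_deriv h x v).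

Lemma clarke_deriv_le h x v (c : \bar R) (r : R) : 0 < r ->
  (forall y l, `|y - x| < r -> 0 < l -> l < r ->
    ((diff_quot h v (y, l))%:E <= c)%E) -> (clarke_deriv h x v <= c)%E.
Proof.
move=> r0 rc; rewrite /clarke_deriv limf_esupE.
apply: ge_ereal_inf; exists (ereal_sup ((fun p => (diff_quot h v p)%:E) @`
   (ball x r `*` `]0, r[%classic))); last first.
  apply: ge_ereal_sup => _ [[y l] [/= yx lr] <-].
  move: lr; rewrite in_itv /= => /andP[l0 lr]; apply: rc => //.
  by move: yx; rewrite -ball_normE /ball_ /= distrC.
exists (ball x r `*` `]0, r[%classic) => //.
exists (ball x r, `]0, r[%classic) => //=; split; first exact: nbhsx_ballx.
exists r => //= l; rewrite /= sub0r normrN => lr l0.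
by rewrite in_itv /= l0/=; apply: le_lt_trans lr; exact: ler_norm.
Qed.

Lemma clarke_deriv_lt h x v (c : \bar R) : (clarke_deriv h x v < c)%E ->
  exists2 r : R, 0 < r & forall y l, `|y - x| < r -> 0 < l -> l < r ->
    ((diff_quot h v (y, l))%:E < c)%E.
Proof.
rewrite /clarke_deriv limf_esupE => /ereal_inf_lt[_ [S [[P Q] [/= xP Q0] PQS] <-] Sc].
move/nbhs_ballP : xP => [r1 /= r10 r1P].
move: Q0 => [r2 /= r20 r2Q].
exists (Num.min r1 r2); first by rewrite lt_min r10.
move=> y l; rewrite !lt_min => /andP[yx _] l0 /andP[_ lr].
apply: le_lt_trans Sc; apply: ereal_sup_ubound; exists (y, l) => //.
apply: PQS; split => /=.
  by apply: r1P; rewrite -ball_normE /ball_ /= distrC.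
by apply: r2Q => //=; rewrite sub0r normrN gtr0_norm.
Qed.

Section LocallyLipschitz.
Context (h : X -> R).
Hypothesis hlip : locally_lipschitz h.

Lemma locally_lipschitz_diff_quot x : exists L r : R, [/\ 0 <= L, 0 < r &
  forall y v l, `|y - x| < r -> 0 < l -> l * `|v| < r ->
    `|diff_quot h v (y, l)| <= L * `|v|].
Proof.
have [U xU] := hlip x; move=> [L0 [_ LP]].
have L01 : L0 < `|L0| + 1 by apply: le_lt_trans (ler_norm L0) _; rewrite ltrDl.
move/nbhs_ballP : xU => [r /= r0 rU].
exists (`|L0| + 1), (r / 2); split; [by []|by rewrite divr_gt0|].
move=> y v l yx l0 lv.
have Uy : U y.
  by apply: rU; rewrite -ball_normE /ball_ /= distrC; lra.
have Uyl : U (y + l *: v).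
  apply: rU; rewrite -ball_normE /ball_ /= distrC -addrAC.
  apply: le_lt_trans (ler_normD _ _) _.
  by rewrite normrZ gtr0_norm//; lra.
have := LP (`|L0| + 1) L01.
move=> /(_ (y + l *: v, y)) /=; rewrite addrAC subrr add0r normrZ gtr0_norm// => LL.
rewrite /diff_quot /= normrM normfV (gtr0_norm l0) ler_pdivrMr//.
by rewrite -mulrA (mulrC _ l); exact: LL.
Qed.

Lemma locally_lipschitz_continuous : continuous (h : X -> R^o).
Proof.
move=> x; have [U xU] := hlip x; move=> [L0 [_ LP]].
have L01 : L0 < `|L0| + 1 by apply: le_lt_trans (ler_norm L0) _; rewrite ltrDl.
have := LP (`|L0| + 1) L01.
have L1 : 0 < `|L0| + 1 by rewrite ltr_wpDl.
set L := `|L0| + 1 in L1 * => LL.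
apply/cvgrPdist_lt => e e0; near=> y.
have Uy : U y by near: y.
have := LL (x, y) (conj (nbhs_singleton xU) Uy) => /=.
move=> /le_lt_trans; apply.
rewrite mulrC -ltr_pdivlMr//.
by near: y; apply: (@cvgr_dist_lt _ _ _ _ _ id) => //; rewrite divr_gt0.
Unshelve. all: by end_near. Qed.

Lemma clarke_deriv_bounds x : exists L r : R, [/\ 0 <= L, 0 < r &
  forall y v, `|y - x| < r -> ((- (L * `|v|))%:E <= clarke_deriv h y v <= (L * `|v|)%:E)%E].
Proof.
have [L [r [L0 r0 LP]]] := locally_lipschitz_diff_quot x.
exists L, (r / 2); split; [by []|by rewrite divr_gt0|move=> y v yx].
pose r1 := Num.min (r / 2) (r / (`|v| + 1)).
have v1 : 0 < `|v| + 1 by rewrite ltr_wpDl.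
have r10 : 0 < r1 by rewrite lt_min !divr_gt0.
have Lq z l : `|z - y| < r1 -> 0 < l -> l < r1 -> `|diff_quot h v (z, l)| <= L * `|v|.
  rewrite !lt_min => /andP[zy _] l0 /andP[_ lr]; apply: LP => //.
    by have := ler_normD (z - y) (y - x); rewrite addrA subrK; lra.
  move: lr; rewrite ltr_pdivlMr//.
  have : l * `|v| <= l * (`|v| + 1) by rewrite ler_wpM2l ?(ltW l0)//; lra.
  by move=> a b; exact: le_lt_trans a b.
apply/andP; split; last first.
  apply: (clarke_deriv_le r10) => z l zy l0 lr.
  by rewrite lee_fin; apply: le_trans (ler_norm _) _; exact: Lq.
rewrite leNgt; apply/negP => /clarke_deriv_lt[r2 r20 r2P].
pose l := Num.min r1 r2 / 2.
have m0 : 0 < Num.min r1 r2 by rewrite lt_min r10.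
have l0 : 0 < l by rewrite divr_gt0.
have lm : l < Num.min r1 r2 by rewrite /l; lra.
move: lm; rewrite lt_min => /andP[lr1 lr2].
have := r2P y l; rewrite subrr normr0 lte_fin => /(_ r20 l0 lr2).
have := Lq y l; rewrite subrr normr0 => /(_ r10 l0 lr1).
by rewrite ler_norml => /andP[a _]; rewrite ltNge a.
Qed.

Lemma clarke_derivE x v : clarke_deriv h x v = (clarke h x v)%:E.
Proof.
have [L [r [L0 r0 LP]]] := clarke_deriv_bounds x.
have := LP x v; rewrite subrr normr0 => /(_ r0) /andP[a b].
rewrite /clarke fineK// fin_real//; apply/andP; split.
  exact: lt_le_trans (ltNyr _) a.
exact: le_lt_trans b (ltry _).
Qed.

Lemma clarke_bounds x : exists L r : R, [/\ 0 <= L, 0 < r &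
  forall y v, `|y - x| < r -> `|clarke h y v| <= L * `|v|].
Proof.
have [L [r [L0 r0 LP]]] := clarke_deriv_bounds x.
exists L, r; split=> // y v yx; have := LP y v yx.
by rewrite clarke_derivE !lee_fin ler_norml.
Qed.

Lemma clarke_le x v (c r : R) : 0 < r ->
  (forall y l, `|y - x| < r -> 0 < l -> l < r ->
    diff_quot h v (y, l) <= c) -> clarke h x v <= c.
Proof.
move=> r0 rc; rewrite -lee_fin -clarke_derivE; apply: (clarke_deriv_le r0).
by move=> y l yx l0 lr; rewrite lee_fin; exact: rc.
Qed.

Lemma clarke_lt x v (c : R) : clarke h x v < c ->
  exists2 r : R, 0 < r & forall y l, `|y - x| < r -> 0 < l -> l < r ->
    diff_quot h v (y, l) < c.
Proof.
rewrite -lte_fin -clarke_derivE => /clarke_deriv_lt[r r0 rP].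
by exists r => // y l yx l0 lr; rewrite -lte_fin; exact: rP.
Qed.

(** Subadditivity rests on the moving base point of the limsup: the quotient in direction [v + w] at
    [y] is the one in direction [v] at [y + l w] plus the one in direction [w] at [y]. *)
Lemma clarke_sublinear x : sublinear (clarke h x).
Proof.
have clD v w : clarke h x (v + w) <= clarke h x v + clarke h x w.
  apply/ler_addgt0Pr => e e0.
  have [r1 r10 r1P] := @clarke_lt x v (clarke h x v + e / 2) ltac:(lra).
  have [r2 r20 r2P] := @clarke_lt x w (clarke h x w + e / 2) ltac:(lra).
  have v1 : 0 < `|v| + 1 by rewrite ltr_wpDl.
  have w1 : 0 < `|w| + 1 by rewrite ltr_wpDl.
  pose r := Num.min (Num.min (r1 / 2) r2) (r1 / 2 / (`|w| + 1)).
  have r0 : 0 < r by rewrite !lt_min r20 !divr_gt0.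
  apply: (clarke_le r0) => y l; rewrite /r !lt_min => /andP[/andP[y1 y2] _] l0.
  move=> /andP[/andP[l1 l2]]; rewrite ltr_pdivlMr// => lw.
  have -> : diff_quot h (v + w) (y, l) =
      diff_quot h v (y + l *: w, l) + diff_quot h w (y, l).
    rewrite /diff_quot /= -mulrDl -(addrA y) -scalerDr (addrC w).
    by rewrite addrA subrK.
  have h1 : diff_quot h v (y + l *: w, l) < clarke h x v + e / 2.
    apply: r1P => //; last by lra.
    rewrite addrAC; apply: le_lt_trans (ler_normD _ _) _.
    rewrite normrZ gtr0_norm//.
    have : l * `|w| <= l * (`|w| + 1) by rewrite ler_wpM2l ?(ltW l0)//; lra.
    lra.
  have h2 := r2P y l y2 l0 l2; lra.
have cl0 : clarke h x 0 = 0.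
  have [L [r [L0 r0 LP]]] := clarke_bounds x.
  have := LP x 0; rewrite subrr normr0 mulr0 => /(_ r0).
  by rewrite normr_le0 => /eqP.
have clZ l v : 0 < l -> clarke h x (l *: v) <= l * clarke h x v.
  move=> l0; rewrite mulrC -ler_pdivrMr//; apply/ler_addgt0Pr => e e0.
  have [r r0 rP] := @clarke_lt x v (clarke h x v + e) ltac:(lra).
  rewrite ler_pdivrMr//.
  apply: (@clarke_le _ _ _ (Num.min r (r / l))); first by rewrite lt_min r0 divr_gt0.
  move=> y k; rewrite !lt_min => /andP[yr _] k0 /andP[_ kr].
  have -> : diff_quot h (l *: v) (y, k) = diff_quot h v (y, k * l) * l.
    rewrite /diff_quot /= scalerA invfM mulrA mulfVK// gt_eqF//.
  rewrite ler_wpM2r ?(ltW l0)//; apply/ltW/rP => //; first by rewrite mulr_gt0.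
  by rewrite -ltr_pdivlMr.
split=> // l v; rewrite le_eqVlt => /predU1P[<-|l0].
  by rewrite scale0r mul0r.
apply/eqP; rewrite eq_le clZ//=.
have := @clZ l^-1 (l *: v); rewrite invr_gt0 l0 => /(_ erefl).
by rewrite scalerA mulVf ?gt_eqF// scale1r -ler_pdivlMl.
Qed.

(** A bound on the quotients near [x] also holds near every [y] close to [x]. A change of direction
    costs at most the local Lipschitz constant, by subadditivity. *)
Lemma clarke_usc x v (e : R) : 0 < e -> exists2 r : R, 0 < r &
  forall y w, `|y - x| < r -> `|w - v| < r -> clarke h y w <= clarke h x v + e.
Proof.
move=> e0; have [L [r1 [L0 r10 LP]]] := clarke_bounds x.
have [r2 r20 r2P] := @clarke_lt x v (clarke h x v + e / 2) ltac:(lra).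
have L1 : 0 < L + 1 by lra.
exists (Num.min (Num.min r1 (r2 / 2)) (e / 2 / (L + 1))).
  by rewrite !lt_min r10 !divr_gt0.
move=> y w; rewrite !lt_min => /andP[/andP[y1 y2] _] /andP[_].
rewrite ltr_pdivlMr// => wv.
have := (clarke_sublinear y).1 v (w - v); rewrite addrC subrK.
have : clarke h y v <= clarke h x v + e / 2.
  apply: (@clarke_le _ _ _ (r2 / 2)); first by rewrite divr_gt0.
  move=> z l zy l0 lr; apply/ltW/r2P => //; last by lra.
  by have := ler_normD (z - y) (y - x); rewrite addrA subrK; lra.
have := LP y (w - v) y1 => /(le_trans (ler_norm _)).
have : L * `|w - v| <= `|w - v| * (L + 1) by rewrite mulrC ler_wpM2l//; lra.
lra.
Qed.

(** The directional derivative is the support function of the subdifferential: pushing it along [v]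
    before applying Hahn-Banach gives a subgradient that attains it at [v]. This transfers the
    growth condition from subgradients to the derivative. *)
Lemma clarke_le_subdiff x v (c : R) :
  (forall zeta, clarke_subdiff h x zeta -> `|zeta| <= c) -> clarke h x v <= c * `|v|.
Proof.
move=> hc; have [q [sq qc qv]] := sublinear_push v (clarke_sublinear x).
have [z lz zq] := hahn_banach sq.
have [L [r [L0 r0 LP]]] := clarke_bounds x.
have [w|g gz] := dual_of_bound (c := L) lz.
  apply: le_trans (zq w) _; apply: le_trans (qc w) _.
  by apply: le_trans (ler_norm _) _; apply: LP; rewrite subrr normr0.
have /hc gc : clarke_subdiff h x g.
  by move=> w; rewrite clarke_derivE lee_fin gz; exact: le_trans (zq w) (qc w).
have gv : clarke h x v <= g v.
  have : g (- v) <= - clarke h x v by rewrite gz; exact: le_trans (zq _) qv.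
  by rewrite linearN lerN2.
apply: le_trans gv _; apply: le_trans (dual_le g v) _.
by rewrite ler_wpM2r.
Qed.

End LocallyLipschitz.
End Clarke.

(** * Strong measurability *)

#[local] Existing Instance ae_in_filter.

(** * Countable dense families in separable spaces and in graphs *)

Section DenseSequences.
Context (R : realType).
Implicit Types V : normedModType R.

Definition dense_seq V (s : nat -> V) :=
  forall x (e : R), 0 < e -> exists k, `|s k - x| < e.

Lemma separable_seq V : separable V -> exists s : nat -> V, dense_seq s.
Proof.
move=> [S cS dS]; have := cS; move/pfcard_geP => [S0|[g]].
  exfalso; have [x []] := dS setT (ex_intro _ 0 I) openT.
  by rewrite S0.
exists g => x e e0.
have [|y [/= xy Sy]] := dS (ball x e) _ (ball_open x e).
  by exists x; exact: ballxx.
have [k _ gk] := @surj _ _ _ _ g y Sy; exists k; rewrite gk.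
by move: xy; rewrite -ball_normE /ball_ /= distrC.
Qed.

Lemma dense_seq_rat : exists q : nat -> R^o, dense_seq q.
Proof.
exists (fun n => if unpickle n is Some r then ratr r else 0) => x e e0.
have /rat_in_itvoo[r] : x - e < x + e :> R.
  by rewrite ltrBlDr -addrA ltrDl addr_gt0.
rewrite in_itv /= => /andP[r1 r2]; exists (pickle r); rewrite pickleK.
by rewrite ltr_distl r1.
Qed.

(** For each centre [s k], radius [1 / (n + 1)] and rational level [r], pick a point of [K] in that
    ball with [psi] below [r], if there is one; otherwise fall back on [k0]. *)
Lemma graph_dense_exists V (K : set V) (psi : V -> R) : separable V -> K !=set0 ->
  exists D, graph_dense K psi D.
Proof.
move=> /separable_seq[s sP] [k0 Kk0].
pose P (x : nat * nat * rat) a := [/\ K a, `|a - s x.1.1| < x.1.2.+1%:R^-1 &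
   psi a < ratr x.2].
have aP x : exists a, (exists a, P x a) -> P x a.
  have [[a Pa]|nP] := pselect (exists a, P x a); first by exists a.
  by exists 0 => h; exfalso; apply: nP.
have [D0 D0P] := choice aP.
pose D i := if unpickle i is Some x then
   if pselect (exists a, P x a) then D0 x else k0 else k0.
exists D; split=> [i|u e Ku e0].
  rewrite /D; case: unpickle => // x; case: pselect => // /D0P[]//.
have [n nP] : exists n, n.+1%:R^-1 < e / 2.
  exists (Num.bound (e / 2)^-1); rewrite -[ltRHS]invrK ltf_pV2 ?posrE ?invr_gt0 ?divr_gt0//.
  by apply: lt_trans (archi_boundP _) _; rewrite ?invr_ge0 ?divr_ge0 ?(ltW e0)// ltr_nat.
have [k kP] := sP u n.+1%:R^-1 ltac:(by rewrite invr_gt0).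
have /rat_in_itvoo[r] : psi u < psi u + e by rewrite ltrDl.
rewrite in_itv /= => /andP[r1 r2].
have Pu : P (k, n, r) u by split => //=; rewrite distrC.
exists (pickle (k, n, r)); rewrite /D pickleK; case: pselect => [h|[]]; last by exists u.
have [_ /= h1 h2] := D0P _ h; split; last exact: lt_trans r2.
rewrite -(subrK (s k) (D0 _)) -addrA; apply: le_lt_trans (ler_normD _ _) _.
by rewrite [ltRHS]splitr; apply: ltrD; [exact: lt_trans h1 nP|exact: lt_trans kP nP].
Qed.

End DenseSequences.

(** * Measurability up to null sets *)

Section AlmostEverywhere.
Context (R : realType) (T : R).

Lemma ae_in_all (P : nat -> R -> Prop) :
  (forall n, ae_in T (P n)) -> ae_in T (fun t => forall n, P n t).
Proof.
move=> h; have /ae_foralln : forall n, \forall t \ae (@lebesgue_measure R),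
  `]0, T[%classic t -> P n t by exact: h.
by apply: filterS => t ht t0 n; exact: ht.
Qed.

(** Strong measurability is an almost everywhere condition, so scalar functions are likewise only
    required to agree with a measurable one almost everywhere on [(0, T)]. *)
Definition aemeas (g : R -> \bar R) := exists2 g' : R -> \bar R,
  measurable_fun setT g' & ae_in T (fun t => g t = g' t).

Lemma aemeas_cst c : aemeas (fun=> c).
Proof. by exists (cst c) => //; exact: aeW. Qed.

Lemma ae_aemeas g h : ae_in T (fun t => g t = h t) -> aemeas h -> aemeas g.
Proof. by move=> gh [h' mh hh]; exists h' => //; apply: filterS2 gh hh => t ->. Qed.

Lemma aemeasD (g h : R -> R) : aemeas (EFin \o g) -> aemeas (EFin \o h) ->
  aemeas (EFin \o (g \+ h)).
Proof.
move=> [g' mg gg] [h' mh hh]; exists (g' \+ h')%E; first exact: emeasurable_funD.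
by apply: filterS2 gg hh => t /= <- <-.
Qed.

Lemma aemeasN (g : R -> R) : aemeas (EFin \o g) -> aemeas (EFin \o (\- g)).
Proof.
move=> [g' mg gg]; exists (\- g')%E; first exact: measurableT_comp.
by apply: filterS gg => t /= <-.
Qed.

Lemma aemeas_fine (g : R -> \bar R) : aemeas g -> aemeas (fun t => (fine (g t))%:E).
Proof.
move=> [g' mg gg]; exists (fun t => (fine (g' t))%:E).
  by apply/measurable_EFinP; exact: measurableT_comp.
by apply: filterS gg => t ->.
Qed.

Lemma aemeas_seq (g : nat -> R -> \bar R) : (forall n, aemeas (g n)) ->
  exists2 g' : nat -> R -> \bar R, forall n, measurable_fun setT (g' n) &
    ae_in T (fun t => forall n, g n t = g' n t).
Proof.
move=> mg; have h n : exists g' : R -> \bar R, measurable_fun setT g' /\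
    ae_in T (fun t => g n t = g' t) by have [g'] := mg n; exists g'.
have [g' gP] := choice h; exists g' => [n|]; first by have [] := gP n.
by apply: ae_in_all => n; have [] := gP n.
Qed.

Lemma aemeas_ereal_sup (g : nat -> R -> \bar R) : (forall n, aemeas (g n)) ->
  aemeas (fun t => ereal_sup (range (g ^~ t))).
Proof.
move=> mg.
have [g' mg' gg'] := aemeas_seq mg.
exists (fun t => esups (g' ^~ t) 0%N).
  by apply: measurable_fun_esups => n; exact: mg'.
apply: filterS gg' => t gt.
rewrite /esups; congr ereal_sup; apply/seteqP; split.
  by move=> _ [n _ <-]; exists n => //; rewrite gt.
by move=> _ [n _ <-]; exists n => //; rewrite gt.
Qed.

Lemma aemeas_ereal_inf (g : nat -> R -> \bar R) : (forall n, aemeas (g n)) ->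
  aemeas (fun t => ereal_inf (range (g ^~ t))).
Proof.
move=> mg.
have [g' mg' gg'] := aemeas_seq mg.
exists (fun t => einfs (g' ^~ t) 0%N).
  by apply: measurable_fun_einfs => n; exact: mg'.
apply: filterS gg' => t gt.
rewrite /einfs; congr ereal_inf; apply/seteqP; split.
  by move=> _ [n _ <-]; exists n => //; rewrite gt.
by move=> _ [n _ <-]; exists n => //; rewrite gt.
Qed.

Lemma aemeas_cvg (g : nat -> R -> \bar R) (l : R -> \bar R) :
  (forall n, aemeas (g n)) ->
  ae_in T (fun t => g n t @[n --> \oo] --> l t) -> aemeas l.
Proof.
move=> mg gl.
have [g' mg' gg'] := aemeas_seq mg.
exists (fun t => limn_esup (g' ^~ t)).
  by apply: measurable_fun_limn_esup => n; exact: mg'.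
apply: filterS2 gg' gl => t gt glt.
rewrite (_ : g' ^~ t = g ^~ t); last by apply/funext => n; rewrite gt.
by rewrite is_cvg_limn_esupE; [rewrite (cvg_lim _ glt)|apply/cvg_ex; exists (l t)].
Qed.

(** * Simple functions and criteria for strong measurability *)

Section SimpleFun.
Context (V : normedModType R).

Lemma simple_fun_comp_measurable (s : R -> V) (c : V -> \bar R) :
  simple_fun s -> measurable_fun setT (c \o s).
Proof.
move=> [fs ms] _ B mB; rewrite setTI.
have -> : (c \o s) @^-1` B = \bigcup_(x in range s `&` c @^-1` B) (s @^-1` [set x]).
  apply/seteqP; split=> t /=; first by move=> Bt; exists (s t) => //; split => //; exists t.
  by move=> [x [_ Bx] /= ->].
apply: fin_bigcup_measurable => // .
by apply: sub_finite_set fs => x [].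
Qed.

Lemma aemeas_comp (u : R -> V) (c : V -> R) : strongly_measurable T u ->
  continuous (c : V -> R^o) -> aemeas (fun t => (c (u t))%:E).
Proof.
move=> [s ss su] cc; apply: (@aemeas_cvg (fun n t => (c (s n t))%:E)).
  move=> n; exists (fun t => (c (s n t))%:E); last exact: aeW.
  exact: (simple_fun_comp_measurable (fun x => (c x)%:E) (ss n)).
apply: filterS su => t st; apply: cvg_EFin; first exact: nearW.
exact: continuous_cvg (cc _) st.
Qed.

Lemma simple_fun_cst (x : V) : simple_fun (fun _ : R => x).
Proof.
split; first by apply: (sub_finite_set _ (finite_set1 x)) => _ [_ _ <-].
move=> y; have [->|xy] := eqVneq x y.
  by rewrite (_ : _ @^-1` _ = setT)//; apply/seteqP; split.
rewrite (_ : _ @^-1` _ = set0)//; apply/seteqP; split => // t /= xyE.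
by move: xy; rewrite xyE eqxx.
Qed.

Lemma simple_fun_if (B : set R) (s s' : R -> V) : measurable B ->
  simple_fun s -> simple_fun s' -> simple_fun (fun t => if t \in B then s t else s' t).
Proof.
move=> mB [fs ms] [fs' ms']; split.
  apply: (@sub_finite_set _ _ (range s `|` range s')); last by rewrite finite_setU.
  by move=> _ [t _ <-]; case: ifP => _; [left|right]; exists t.
move=> x.
have -> : (fun t => if t \in B then s t else s' t) @^-1` [set x] =
   (B `&` s @^-1` [set x]) `|` (~` B `&` s' @^-1` [set x]).
  apply/seteqP; split=> t /=.
    by case: ifPn; rewrite ?inE ?notin_setE => h h'; [left|right].
  by move=> [[h <-]|[h <-]]; [rewrite mem_set|rewrite memNset].
by apply: measurableU; apply: measurableI => //; exact: measurableC.
Qed.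

(** [m n t] is the minimum of [h' j t] over [j <= n], and the simple function [s n] takes the value
    [D j] at an index [j] attaining it; [B n] is where the new index strictly improves. By the
    second hypothesis on [h], near-minimizers are close to [u t]. *)
Lemma strongly_measurable_select (D : nat -> V) (h : nat -> R -> \bar R) (u : R -> V) :
  (forall j, aemeas (h j)) ->
  ae_in T (fun t => (forall e : R, 0 < e -> exists j, (h j t <= e%:E)%E) /\
    (forall d : R, 0 < d -> exists2 e : R, 0 < e &
      forall j, (h j t <= e%:E)%E -> `|D j - u t| <= d)) ->
  strongly_measurable T u.
Proof.
move=> mh hu.
have [h' mh' hh'] := aemeas_seq mh.
pose m := fix m n t := if n is n'.+1 then mine (m n' t) (h' n t) else h' 0%N t.
pose B n := [set t | h' n.+1 t < m n t]%E.
pose s := fix s n t := if n is n'.+1 then if t \in B n' then D n else s n' t else D 0%N.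
have mm n : measurable_fun setT (m n).
  elim: n => [|n IHn]; first exact: mh'.
  by apply: measurable_mine => //; have [] := hP n.+1.
have mB n : measurable (B n).
  have := @emeasurable_fun_lt _ _ _ _ measurableT _ _ (mh' n.+1) (mm n).
  by rewrite setTI.
have sE n t : exists2 j, (j <= n)%N & s n t = D j /\ m n t = h' j t.
  elim: n => [|n [j jn [sj mj]]]; first by exists 0%N.
  rewrite /=; case: ifPn; rewrite ?inE ?notin_setE /B /= => hm.
    by exists n.+1 => //; split => //; apply/min_idPr/ltW.
  exists j; first by rewrite leqW.
  by split => //; rewrite -mj; apply/min_idPl; rewrite leNgt; apply/negP.
have mle n t j : (j <= n)%N -> (m n t <= h' j t)%E.
  elim: n => [|n IHn]; first by rewrite leqn0 => /eqP ->.
  rewrite leq_eqVlt => /predU1P[->|jn] /=; first by rewrite ge_min lexx orbT.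
  by rewrite ge_min IHn.
exists s.
  elim=> [|n IHn]; first exact: simple_fun_cst.
  by apply: simple_fun_if => //; exact: simple_fun_cst.
apply: filterS2 hh' hu => t ht [hu1 hu2].
apply/cvgrPdist_le => d d0; have [e e0 he] := hu2 d d0.
have [j0 hj0] := hu1 e e0; exists j0 => // n /= j0n.
have [j jn [-> mj]] := sE n t; rewrite distrC; apply: he.
by rewrite ht -mj; apply: le_trans (mle n t j0 j0n) _; rewrite -ht.
Qed.

(** A criterion in the spirit of Pettis: measurable distances to a dense sequence suffice. It makes
    strong measurability stable under pointwise limits. *)
Lemma strongly_measurable_dist (D : nat -> V) (u : R -> V) : dense_seq D ->
  (forall j, aemeas (fun t => `|D j - u t|%:E)) -> strongly_measurable T u.
Proof.
move=> Dd mD; apply: (@strongly_measurable_select D _ u mD); apply: aeW => t _; split.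
  by move=> e e0; have [k ke] := Dd (u t) e e0; exists k; rewrite lee_fin ltW.
by move=> d d0; exists d => // j; rewrite lee_fin.
Qed.

Lemma strongly_measurable_lim (u : nat -> R -> V) (l : R -> V) : separable V ->
  (forall n, strongly_measurable T (u n)) ->
  ae_in T (fun t => u n t @[n --> \oo] --> l t) -> strongly_measurable T l.
Proof.
move=> /separable_seq[D Dd] mu ul; apply: (strongly_measurable_dist Dd) => j.
apply: (@aemeas_cvg (fun n t => `|D j - u n t|%:E)) => [n|].
  apply: (@aemeas_comp _ (fun x => `|D j - x|)) => // x.
  by apply: cvg_norm; apply: cvgB; [exact: cvg_cst|exact: cvg_id].
apply: filterS ul => t ut; apply: cvg_EFin; first exact: nearW.
by apply: cvg_norm; apply: cvgB => //; exact: cvg_cst.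
Qed.

End SimpleFun.
End AlmostEverywhere.

(** * Square integrable functions *)

Section LowerIntegral.
Context d (U : measurableType d) (R : realType) (mu : {measure set U -> \bar R}).
Implicit Types (D : set U) (f g : U -> \bar R).
Import HBNNSimple.
Local Open Scope ereal_scope.

(* The integral of a nonnegative function that is not measurable is its lower
   integral, hence comparisons only need one of the two sides measurable. *)
Lemma ae_le_integral_measurabler D f g : measurable D -> measurable_fun D g ->
  (forall x, D x -> 0 <= f x) -> (forall x, D x -> 0 <= g x) ->
  (\forall x \ae mu, D x -> f x <= g x) ->
  \int[mu]_(x in D) f x <= \int[mu]_(x in D) g x.
Proof.
move=> mD mg f0 g0 fg; rewrite [leLHS]ge0_integralE//.
apply: ge_ereal_sup => _ [h hf <-].
have -> : sintegral mu h = \int[mu]_x (h x)%:E.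
  by rewrite integral_nnsfun// patch_setT.
rewrite [leRHS]integral_mkcond; apply: ae_ge0_le_integral => //.
- by move=> x _; rewrite lee_fin.
- by apply/measurable_EFinP.
- by move=> x _; apply: erestrict_ge0.
- exact/(measurable_restrictT _ _).1.
- apply: filterS fg => x fgx _; apply: le_trans (hf x) _; rewrite /patch.
  by case: ifPn => // /set_mem; exact: fgx.
Qed.

Lemma ae_le_integral_measurablel D f g : measurable D -> measurable_fun D g ->
  (forall x, D x -> 0 <= f x) -> (forall x, D x -> 0 <= g x) ->
  (\forall x \ae mu, D x -> g x <= f x) ->
  \int[mu]_(x in D) g x <= \int[mu]_(x in D) f x.
Proof.
move=> mD mg f0 g0 [N [mN N0 gfN]].
rewrite (ge0_negligible_integral mN mD mg g0 N0).
rewrite ge0_integralE; last by move=> x [Dx _]; exact: g0.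
rewrite [leRHS]ge0_integralE//.
apply: ereal_sup_le => _ [h hg <-]; exists h => //= x.
apply: le_trans (hg x) _; rewrite /patch.
have [xDN|] := boolP (x \in D `\` N); last first.
  by case: ifPn => // /set_mem /f0.
have [Dx Nx] := set_mem xDN; rewrite mem_set//.
by apply: contrapT => gf; apply/Nx/gfN => /(_ Dx).
Qed.

End LowerIntegral.

(** * Integrals over [[0, t]], an interval contained in [(0, T)] up to the null set [{0}] *)

Section TimeIntervals.
Context (R : realType) (T : R).
Local Notation mu := (@lebesgue_measure R).

Lemma ae_in_restr (P : R -> Prop) :
  ae_in T (fun t => `]0, T[%classic t -> P t) -> ae_in T P.
Proof.
by apply: (@filterS _ _ (ae_filter_ringOfSetsType mu)) => t h t0; exact: h.
Qed.

Lemma ae_in_closed_left (P : R -> Prop) t : t < T -> ae_in T P ->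
  \forall s \ae mu, `[0, t]%classic s -> P s.
Proof.
move=> tT aeP.
have n0 : \forall s \ae mu, s != 0 :> R.
  exists [set 0]; split => //; first exact: lebesgue_measure_set1.
  by move=> s /= /negP; rewrite negbK => /eqP.
rewrite /ae_in in aeP.
apply: (@filterS2 _ _ (ae_filter_ringOfSetsType mu) _ _ _ _ aeP n0) => s Ps s0.
rewrite /= in_itv /= => /andP[s1 s2].
by apply: Ps; rewrite /= in_itv /= lt_def s0 s1 (le_lt_trans s2).
Qed.

(** [f] is not assumed measurable; comparison with [g] makes its lower integral finite, so that
    [fine] preserves its value. *)
Lemma Rintegral_le_ae (f g : R -> R) (t c : R) : t < T -> measurable_fun setT g ->
  (forall s, 0 <= f s) -> (forall s, 0 <= g s) -> ae_in T (fun s => f s <= g s) ->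
  (\int[mu]_(s in `[0%R, t]) (g s)%:E <= c%:E)%E ->
  \int[mu]_(s in `[0, t]) f s <= c.
Proof.
move=> tT mg f0 g0 fg gc; have h : (\int[mu]_(s in `[0%R, t]) (f s)%:E <= c%:E)%E.
  apply: le_trans gc; apply: ae_le_integral_measurabler => //.
  - by apply: (@measurable_funS _ _ _ _ setT) => //; apply/measurable_EFinP.
  - by move=> x _; rewrite lee_fin.
  - by move=> x _; rewrite lee_fin.
  - apply: (@filterS _ _ (ae_filter_ringOfSetsType mu) _ _ _ (ae_in_closed_left tT fg)).
    by move=> s fgs /fgs; rewrite lee_fin.
have h0 : (0 <= \int[mu]_(s in `[0%R, t]) (f s)%:E)%E.
  by apply: integral_ge0 => s _; rewrite lee_fin.
rewrite /Rintegral -lee_fin fineK// ge0_fin_numE//.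
exact: le_lt_trans h (ltry _).
Qed.

Lemma Rintegral_le_cst (f : R -> R) (t c : R) : 0 < t -> t < T -> 0 <= c ->
  (forall s, 0 <= f s) -> ae_in T (fun s => f s <= c) ->
  \int[mu]_(s in `[0, t]) f s <= c * T.
Proof.
move=> t0 tT c0 f0 fc; apply: (@Rintegral_le_ae f (cst c)) => //.
rewrite (integral_cst mu _ c%:E)//= lebesgue_measure_itv/= lte_fin t0 sube0 -EFinM lee_fin.
by rewrite ler_wpM2l// ltW.
Qed.

Lemma Rintegral_le_exp (f : R -> R) (t b l : R) : 0 < t -> t < T -> 0 <= b -> 0 < l ->
  (forall s, 0 <= f s) -> ae_in T (fun s => f s <= b * expR (l * s)) ->
  \int[mu]_(s in `[0, t]) f s <= b / l * expR (l * t).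
Proof.
move=> t0 tT b0 l0 f0 fc.
apply: (@Rintegral_le_ae f (fun s => b * expR (l * s))) => //.
- have ml : measurable_fun setT (fun s : R => l * s) by exact: measurable_funM.
  apply: measurable_funM => //.
  by apply: (@measurableT_comp _ _ _ _ _ _ (@expR R) _ (fun s => l * s)).
- by move=> s; rewrite mulr_ge0// expR_ge0.
pose F s := b / l * expR (l * s).
have dF (x : R) : is_derive x 1 F (b * expR (l * x)).
  have d1 : is_derive x 1 (fun s => l * s) l.
    by apply: is_derive_eq; rewrite ?scaler0 ?add0r ?addr0 /GRing.scale/= ?mulr1.
  have d2 := is_derive1_comp (is_derive_expR (l * x)) d1.
  have d3 : is_derive x 1 (fun s => b / l * (expR \o (fun s => l * s)) s)
      (b / l * (expR (l * x) * l)).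
    by apply: is_derive_eq; rewrite ?scaler0 ?add0r ?addr0 /GRing.scale/=.
  have -> : b * expR (l * x) = b / l * (expR (l * x) * l).
    by field; rewrite gt_eqF.
  exact: d3.
have cF : continuous F by move=> x; apply/differentiable_continuous/derivable1_diffP.
rewrite (@continuous_FTC2 _ _ F)//.
- rewrite -EFinB lee_fin gerBl /F; apply: mulr_ge0; last exact: expR_ge0.
  by apply: divr_ge0 => //; exact: ltW.
- apply: continuous_subspaceT => x; apply: cvgM; first exact: cvg_cst.
  apply: continuous_comp; last exact: continuous_expR.
  by apply: cvgM; [exact: cvg_cst|exact: cvg_id].
- split; first by move=> x _; have [] := dF x.
  + exact: cvg_at_right_filter (cF 0).
  + exact: cvg_at_left_filter (cF t).
- by move=> x _; rewrite derive1E; have [_ ->] := dF x.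
Qed.

End TimeIntervals.

Section SquareIntegrable.
Context (R : realType) (T : R).
Local Notation mu := (@lebesgue_measure R).

(** Measurability is asked of the majorant only, so bounds can be added and scaled without any for
    [b]. *)
Definition L2_dominated (b : R -> R) : Prop := exists g : R -> R,
  [/\ measurable_fun setT g, forall t, 0 <= g t, ae_in T (fun t => b t <= g t) &
      (\int[mu]_(t in `]0%R, T[) (g t ^+ 2)%:E < +oo)%E].

Lemma L2_dominated_cst c : 0 <= c -> L2_dominated (fun=> c).
Proof.
move=> c0; exists (cst c); split => //; first exact: aeW.
rewrite (integral_cst mu _ (c ^+ 2)%:E)//= lebesgue_measure_itv/=; case: ifPn => _.
  by rewrite sube0 -EFinM ltry.
by rewrite mule0 ltry.
Qed.

Lemma L2_dominatedD b b' : L2_dominated b -> L2_dominated b' ->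
  L2_dominated (fun t => b t + b' t).
Proof.
move=> [g [mg g0 bg ig]] [g' [mg' g0' bg' ig']]; exists (fun t => g t + g' t); split.
- exact: measurable_funD.
- by move=> t; rewrite addr_ge0.
- by apply: filterS2 bg bg' => t; exact: lerD.
have mm (h : R -> R) : measurable_fun setT h ->
    measurable_fun `]0%R, T[ (fun t => (h t ^+ 2)%:E).
  move=> mh; apply: (@measurable_funS _ _ _ _ setT) => //.
  by apply/measurable_EFinP; exact: measurable_funX.
apply: (@le_lt_trans _ _ (\int[mu]_(t in `]0%R, T[)
  (2%:E * (g t ^+ 2)%:E + 2%:E * (g' t ^+ 2)%:E))%E).
  apply: ge0_le_integral => //.
  - by move=> t _; rewrite lee_fin sqr_ge0.
  - by apply: (mm (fun t => g t + g' t)); exact: measurable_funD.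
  - by apply: emeasurable_funD; apply: measurable_funeM; exact: mm.
  - move=> t _; rewrite -!EFinM -EFinD lee_fin.
    have := sqr_ge0 (g t - g' t); lra.
rewrite ge0_integralD//.
- rewrite !ge0_integralZl//; try exact: mm.
  + by rewrite lte_add_pinfty// lte_mul_pinfty.
  + by move=> t _; rewrite lee_fin sqr_ge0.
  + by move=> t _; rewrite lee_fin sqr_ge0.
- by move=> t _; rewrite -EFinM lee_fin mulr_ge0// sqr_ge0.
- by apply: measurable_funeM; exact: mm.
- by move=> t _; rewrite -EFinM lee_fin mulr_ge0// sqr_ge0.
- by apply: measurable_funeM; exact: mm.
Qed.

Lemma L2_dominatedZ c b : 0 <= c -> L2_dominated b -> L2_dominated (fun t => c * b t).
Proof.
move=> c0 [g [mg g0 bg ig]]; exists (fun t => c * g t); split.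
- exact: measurable_funM.
- by move=> t; rewrite mulr_ge0.
- by apply: filterS bg => t; exact: ler_wpM2l.
have -> : (fun t => ((c * g t) ^+ 2)%:E) = (fun t => (c ^+ 2)%:E * (g t ^+ 2)%:E)%E.
  by apply/funext => t; rewrite exprMn EFinM.
rewrite ge0_integralZl//.
- by rewrite lte_mul_pinfty// lee_fin sqr_ge0.
- apply: (@measurable_funS _ _ _ _ setT) => //.
  by apply/measurable_EFinP; exact: measurable_funX.
- by move=> t _; rewrite lee_fin sqr_ge0.
- by rewrite lee_fin sqr_ge0.
Qed.

Lemma L2_dominatedS b b' : ae_in T (fun t => b t <= b' t) -> L2_dominated b' ->
  L2_dominated b.
Proof.
move=> bb' [g [mg g0 bg ig]]; exists g; split => //.
by apply: filterS2 bb' bg => t; exact: le_trans.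
Qed.

Lemma L2_dominated_norm (V : normedModType R) (u : R -> V) :
  square_integrable T u -> L2_dominated (fun t => `|u t|).
Proof.
move=> [mu' iu].
have [g' mg gg] := aemeas_comp (c := fun x : V => `|x|) mu' (@norm_continuous _ _).
have mg1 : measurable_fun setT (fun t => `|fine (g' t)|).
  by apply: measurableT_comp => //; exact: measurableT_comp.
exists (fun t => `|fine (g' t)|); split => //.
  by apply: filterS gg => t <- /=; rewrite normr_id.
apply: le_lt_trans iu; apply: ae_le_integral_measurablel => //.
- apply: (@measurable_funS _ _ _ _ setT) => //.
  by apply/measurable_EFinP; exact: measurable_funX.
- suff : ae_in T (fun t => (`|fine (g' t)| ^+ 2)%:E <= (`|u t| ^+ 2)%:E)%E by move=> h; exact: h.
  by apply: filterS gg => t <- /=; rewrite normr_id.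
Qed.

Lemma square_integrable_dominated (V : normedModType R) (u : R -> V) :
  strongly_measurable T u -> L2_dominated (fun t => `|u t|) -> square_integrable T u.
Proof.
move=> mu' [g [mg g0 bg ig]]; split => //; apply: le_lt_trans ig.
apply: ae_le_integral_measurabler => //.
- apply: (@measurable_funS _ _ _ _ setT) => //.
  by apply/measurable_EFinP; exact: measurable_funX.
- by move=> t _; rewrite lee_fin sqr_ge0.
- suff : ae_in T (fun t => (`|u t| ^+ 2)%:E <= (g t ^+ 2)%:E)%E by move=> h; exact: h.
  by apply: filterS bg => t ugt; rewrite lee_fin lerXn2r// nnegrE.
Qed.

(** A square integrable majorant [g] satisfies [g <= 1 + g^2], which is integrable on the bounded
    interval; its integral over [(0, T)] bounds all partial integrals. *)
Lemma Rintegral_le_dominated (b f : R -> R) : L2_dominated b ->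
  (forall s, 0 <= f s) -> ae_in T (fun s => f s <= b s) ->
  exists2 B, 0 <= B & forall t, 0 < t -> t < T -> \int[mu]_(s in `[0, t]) f s <= B.
Proof.
move=> [g [mg g0 bg ig]] f0 fb.
pose G := (fun s => 1 + g s ^+ 2) \_ `]0, T[.
have mG1 : measurable_fun setT (fun s => 1 + g s ^+ 2).
  by apply: measurable_funD => //; exact: measurable_funX.
have mG : measurable_fun setT G.
  by apply/(measurable_restrictT _ _).1 => //; exact: (@measurable_funS _ _ _ _ setT).
have G0 s : 0 <= G s.
  by rewrite /G /patch; case: ifPn => // _; rewrite addr_ge0// sqr_ge0.
have iG : (\int[mu]_s (G s)%:E < +oo)%E.
  have -> : (fun s => (G s)%:E) = (fun s => (1 + g s ^+ 2)%:E) \_ `]0, T[.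
    by apply/funext => s; rewrite /G /patch; case: ifP.
  rewrite -integral_mkcond.
  under eq_integral do rewrite EFinD.
  rewrite ge0_integralD//.
  - rewrite lte_add_pinfty// (integral_cst mu _ 1%:E)//= lebesgue_measure_itv/=; case: ifPn => _.
      by rewrite sube0 -EFinM ltry.
    by rewrite mule0 ltry.
  - by move=> t _; rewrite lee_fin sqr_ge0.
  - apply: (@measurable_funS _ _ _ _ setT) => //.
    by apply/measurable_EFinP; exact: measurable_funX.
have iG0 : (0 <= \int[mu]_s (G s)%:E)%E by apply: integral_ge0 => s _; rewrite lee_fin.
exists (fine (\int[mu]_s (G s)%:E)); first exact: fine_ge0.
move=> t t0 tT; apply: (Rintegral_le_ae tT mG) => //.
  apply: ae_in_restr; apply: filterS2 fb bg => s fbs bgs s0.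
  rewrite /G /patch mem_set//.
  apply: le_trans fbs (le_trans bgs _).
  have := sqr_ge0 (g s - 1); have := g0 s; nra.
rewrite fineK ?ge0_fin_numE//; apply: ge0_subset_integral => //.
  by apply/measurable_EFinP.
by move=> s _; rewrite lee_fin.
Qed.

End SquareIntegrable.

(** * Measurability of the Clarke derivative *)

Section ClarkeMeasurable.
Context (R : realType) (X : normedModType R).
Implicit Types (h : X -> R) (x y v : X).

Lemma diff_quot_continuous h v y (l e : R) : continuous (h : X -> R^o) -> 0 < l ->
  0 < e -> exists2 d : R, 0 < d & forall y' l', `|y' - y| < d -> `|l' - l| < d ->
    diff_quot h v (y, l) <= diff_quot h v (y', l') + e.
Proof.
move=> ch l0 e0.
have : (diff_quot h v p : R^o) @[p --> (y, l)] --> (diff_quot h v (y, l) : R^o).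
  have c1 : (p.1 : X) @[p --> (y, l)] --> y by exact: cvg_fst.
  have c2 : (p.2 : R^o) @[p --> (y, l)] --> (l : R^o) by exact: cvg_snd.
  have c3 : (p.1 + p.2 *: v : X) @[p --> (y, l)] --> y + l *: v.
    by apply: cvgD => //; exact: cvgZr_tmp.
  have c4 := continuous_cvg _ (ch (y + l *: v)) c3.
  have c5 := continuous_cvg _ (ch y) c1.
  have c6 : (p.2^-1 : R^o) @[p --> (y, l)] --> (l^-1 : R^o).
    by apply: cvgV => //; rewrite gt_eqF.
  have c7 : (h (p.1 + p.2 *: v) - h p.1 : R^o) @[p --> (y, l)] -->
    (h (y + l *: v) - h y : R^o).
    by apply: cvgB; [exact: c4|exact: c5].
  have c8 : ((h (p.1 + p.2 *: v) - h p.1) * p.2^-1 : R) @[p --> (y, l)] -->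
    ((h (y + l *: v) - h y) * l^-1 : R).
    by apply: cvgM; [exact: c7|exact: c6].
  exact: c8.
move=> /cvgrPdist_lt /(_ e e0) [[P Q] [/= yP lQ] PQ].
move/nbhs_ballP : yP => [d1 /= d10 d1P]; move/nbhs_ballP : lQ => [d2 /= d20 d2Q].
exists (Num.min d1 d2); first by rewrite lt_min d10.
move=> y' l'; rewrite !lt_min => /andP[y1 _] /andP[_ l1].
have PQl : P y' /\ Q l'.
  split; first by apply: d1P; rewrite -ball_normE /ball_ /= distrC.
  by apply: d2Q; rewrite -ball_normE /ball_ /= distrC.
have := PQ (y', l') PQl; rewrite /= ltr_norml => /andP[_].
by rewrite ltrBlDl => /ltW; rewrite addrC.
Qed.

(** [k] encodes a pair of indices; [-oo] is the neutral value for the supremum over [k]. *)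
Definition clarke_approx (s : nat -> X) (q : nat -> R) h x v (n k : nat) : \bar R :=
  if (unpickle k : option (nat * nat)) is Some (a, b) then
    if [&& `|s a - x| < n.+1%:R^-1, 0 < q b & q b < n.+1%:R^-1]
    then (diff_quot h v (s a, q b))%:E else -oo%E
  else -oo%E.

(** Difference quotients are continuous in the base point and in the step [l > 0], so the supremum
    over each neighbourhood is reached along dense sequences. Countable suprema and infima then
    preserve measurability in [t]. *)
Lemma clarke_deriv_approx (s : nat -> X) (q : nat -> R^o) h x v :
  dense_seq s -> dense_seq q -> continuous (h : X -> R^o) ->
  clarke_deriv h x v =
    ereal_inf (range (fun n => ereal_sup (range (clarke_approx s q h x v n)))).
Proof.
move=> sd qd ch; apply/eqP; rewrite eq_le; apply/andP; split.
  apply: le_ereal_inf_tmp => _ [n _ <-].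
  have n0 : 0 < n.+1%:R^-1 :> R by rewrite invr_gt0.
  apply: (clarke_deriv_le n0) => y l; set r := n.+1%:R^-1 in n0 * => yx l0 lr.
  apply/lee_addgt0Pr => e e0.
  have [d d0 dP] := diff_quot_continuous v y ch l0 e0.
  have yr0 : 0 < Num.min d (r - `|y - x|) by rewrite lt_min d0 subr_gt0.
  have lr0 : 0 < Num.min d (Num.min l (r - l)) by rewrite !lt_min d0 l0 subr_gt0.
  have [a] := sd y _ yr0; rewrite lt_min => /andP[a1 a2].
  have [b] := qd l _ lr0; rewrite !lt_min => /and3P[b1 b2 b3].
  apply: (@le_trans _ _ ((diff_quot h v (s a, q b))%:E + e%:E)%E).
    by rewrite -EFinD lee_fin; exact: dP.
  rewrite leeD2r//; apply: ereal_sup_ubound; exists (pickle (a, b)) => //.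
  rewrite /clarke_approx pickleK ifT//; apply/and3P; split.
  - by have := ler_normD (s a - y) (y - x); rewrite addrA subrK -/r; lra.
  - by move: b2; rewrite ltr_norml => /andP[+ _]; rewrite ltrBrDl subrr.
  - by move: b3; rewrite ltr_norml => /andP[_]; rewrite ltrBlDr subrK.
rewrite /clarke_deriv limf_esupE.
apply: le_ereal_inf_tmp => _ [S [[P Q] [/= xP Q0] PQS] <-].
move/nbhs_ballP : xP => [r1 /= r10 r1P].
move: Q0 => [r2 /= r20 r2Q].
have r0 : 0 < Num.min r1 r2 by rewrite lt_min r10.
have [n nP] : exists n, n.+1%:R^-1 < Num.min r1 r2.
  exists (Num.bound (Num.min r1 r2)^-1); rewrite -[ltRHS]invrK ltf_pV2 ?posrE ?invr_gt0//.
  by apply: lt_trans (archi_boundP _) _; rewrite ?invr_ge0 ?(ltW r0)// ltr_nat.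
move: nP; rewrite lt_min => /andP[n1 n2].
apply: ge_ereal_inf; exists (ereal_sup (range (clarke_approx s q h x v n))); first by exists n.
apply: ge_ereal_sup => _ [k _ <-]; rewrite /clarke_approx.
case: unpickle => [[a b]|]; last by rewrite leNye.
case: ifPn => [/and3P[sx q0 qn]|_]; last by rewrite leNye.
apply: ereal_sup_ubound; exists (s a, q b) => //; apply: PQS; split => /=.
  by apply: r1P; rewrite -ball_normE /ball_ /= distrC (lt_trans sx).
by apply: r2Q => //=; rewrite sub0r normrN gtr0_norm// (lt_trans qn).
Qed.

Lemma aemeas_clarke (T : R) (J : R -> X -> R) x v : separable X ->
  (forall y, strongly_measurable T (fun t => J t y : R^o)) ->
  ae_in T (fun t => locally_lipschitz (J t)) ->
  aemeas T (fun t => clarke_deriv (J t) x v).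
Proof.
move=> /separable_seq[s sd] mJ lJ; have [q qd] := dense_seq_rat R.
apply: (@ae_aemeas _ _ _ (fun t => ereal_inf (range (fun n =>
    ereal_sup (range (clarke_approx s q (J t) x v n)))))).
  apply: filterS lJ => t /locally_lipschitz_continuous cJ.
  exact: clarke_deriv_approx.
apply: (@aemeas_ereal_inf _ _ (fun n t => ereal_sup (range (clarke_approx s q (J t) x v n)))) => n.
apply: (@aemeas_ereal_sup _ _ (fun k t => clarke_approx s q (J t) x v n k)) => k.
rewrite /clarke_approx; case: unpickle => [[a b]|]; last exact: aemeas_cst.
case: [&& _, _ & _]; last exact: aemeas_cst.
have mJE y : aemeas T (EFin \o (fun t => J t y)).
  by apply: (aemeas_comp (c := fun z : R^o => z)) => // z; exact: cvg_id.
have [g mg gE] := aemeasD (mJE (s a + q b *: v)) (aemeasN (mJE (s a))).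
exists (fun t => g t * ((q b)^-1)%:E)%E.
  by apply: emeasurable_funM => //; exact: measurable_cst.
by apply: filterS gE => t /= <-; rewrite -EFinM.
Qed.

End ClarkeMeasurable.

(** * Volterra fixed points *)

Section L2Classes.
Context (R : realType) (T : R) (V : normedModType R).

Definition L2_class (u : R -> V) (uP : square_integrable T u) : L2 V T :=
  \pi_(L2 V T)%qT (MkL2fun uP).

Lemma L2_classE u (uP : square_integrable T u) :
  ae_in T (fun t => L2_class uP t = u t).
Proof.
have : \pi_(L2 V T)%qT (repr (L2_class uP)) = \pi_(L2 V T)%qT (MkL2fun uP).
  by rewrite reprK.
by move/eqquotP => /asboolP.
Qed.

Lemma L2_ext (u v : L2 V T) : ae_in T (fun t => u t = v t) -> u = v.
Proof.
by move=> uv; rewrite -[u]reprK -[v]reprK; apply/eqquotP/asboolP.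
Qed.

Lemma L2_square_integrable (u : L2 V T) : square_integrable T u.
Proof. exact: L2fun_valP. Qed.

Lemma L2_strongly_measurable (u : L2 V T) : strongly_measurable T u.
Proof. by have [] := L2_square_integrable u. Qed.

Lemma L2_dominated_L2 (u : L2 V T) : L2_dominated T (fun t => `|u t|).
Proof. exact: L2_dominated_norm (L2_square_integrable u). Qed.

Lemma L2_inhabited : L2 V T.
Proof.
apply: (@L2_class (fun=> 0)); apply: square_integrable_dominated.
  by exists (fun _ _ => 0) => [n|]; [exact: simple_fun_cst|apply: aeW => t _; exact: cvg_cst].
by apply: (L2_dominatedS _ (L2_dominated_cst T (lexx 0))); apply: aeW => t _; rewrite normr0.
Qed.

End L2Classes.

Lemma le_geometric0 (R : realType) (x c : R) :
  (forall n, x <= c * 2^-1 ^+ n) -> x <= 0.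
Proof.
move=> xc; rewrite leNgt; apply/negP => x0.
have c0 : 0 < c by have := xc 0%N; rewrite expr0 mulr1; exact: lt_le_trans.
pose n := Num.bound (c / x).
have h1 : c / x < n%:R by apply: archi_boundP; rewrite divr_ge0// ltW.
have h2 : n%:R <= 2 ^+ n :> R by rewrite -natrX ler_nat ltnW// ltn_expl.
have := xc n; rewrite exprVn ler_pdivlMr ?exprn_gt0// leNgt => /negP; apply.
by rewrite mulrC -ltr_pdivrMr//; exact: lt_le_trans h2.
Qed.

Lemma geometric_cvg (R : realType) (V : completeNormedModType R) (x : nat -> V) (c : R) :
  0 <= c -> (forall n, `|x n.+1 - x n| <= c * 2^-1 ^+ n) ->
  exists l, forall n, `|l - x n| <= 2 * c * 2^-1 ^+ n.
Proof.
move=> c0 xc.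
have h n k : `|x (n + k)%N - x n| <= 2 * c * 2^-1 ^+ n - 2 * c * 2^-1 ^+ (n + k).
  elim: k => [|k IHk]; first by rewrite addn0 !subrr normr0.
  rewrite addnS -(subrK (x (n + k)%N) (x _.+1)) -addrA.
  apply: le_trans (ler_normD _ _) _; apply: le_trans (lerD (xc _) IHk) _.
  rewrite exprS; set p := 2^-1 ^+ (n + k); lra.
have h' n k : `|x (n + k)%N - x n| <= 2 * c * 2^-1 ^+ n.
  by apply: le_trans (h n k) _; rewrite gerBl mulr_ge0 ?exprn_ge0// mulr_ge0.
have xcvg : cvgn x.
  apply/cauchy_cvgP/cauchy_ballP => e e0.
  have [n nP] : exists n, 2 * (2 * c * 2^-1 ^+ n) < e.
    apply: contrapT => /forallNP hn.
    have : e <= 0.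
      apply: (@le_geometric0 _ _ (2 * (2 * c))) => n; rewrite leNgt -mulrA; apply/negP.
      exact: hn.
    by rewrite leNgt e0.
  pose S : set V := x @` [set m | (n <= m)%N].
  exists (S, S); first by split; exists n => // k nk; exists k.
  move=> [_ _] [[p /= np <-] [q /= nq <-]]; rewrite -ball_normE /ball_ /=.
  have := h' n (p - n)%N; have := h' n (q - n)%N; rewrite !subnKC// => hq hp.
  have := ler_normD (x p - x n) (x n - x q); rewrite addrA subrK (distrC (x n)); lra.
move/cvg_ex : xcvg => [l xl]; exists l => n.
have : `|x k - x n| @[k --> \oo] --> `|l - x n|.
  by apply: cvg_norm; apply: cvgB => //; exact: cvg_cst.
move=> /cvgr_to_le; apply; exists n => // k /= nk.
by have := h' n (k - n)%N; rewrite subnKC.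
Qed.

Section Volterra.
Context (R : realType) (T : R) (V : completeNormedModType R) (C : R).
Context (P : L2 V T -> L2 V T).
Hypothesis C_gt0 : 0 < C.
Hypothesis PC : forall u v : L2 V T, \ae t \in(0, T),
  `|P u t - P v t| <= C * \int[lebesgue_measure]_(s in `[0, t]) `|u s - v s|.

Lemma ae_in_Ioo (Q : R -> Prop) : (forall t, 0 < t -> t < T -> Q t) -> ae_in T Q.
Proof. by move=> h; apply: aeW => t; rewrite /= in_itv /= => /andP[]; exact: h. Qed.

(** [u - v] may be unbounded, but after one application of [P] the difference is bounded, which
    gives access to uniform estimates. *)
Lemma volterra_bounded (u v : L2 V T) : exists2 b, 0 <= b &
  \ae t \in(0, T), `|P u t - P v t| <= b.
Proof.
have [] := @Rintegral_le_dominated _ T (fun t => `|u t| + `|v t|) (fun t => `|u t - v t|).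
- by apply: L2_dominatedD; exact: L2_dominated_L2.
- by [].
- by apply: aeW => t _; exact: ler_normB.
move=> B B0 hB; exists (C * B); first by rewrite mulr_ge0// ltW.
apply: filterS2 (PC u v) (ae_in_Ioo hB) => t h1 h2.
by apply: le_trans h1 _; rewrite ler_wpM2l// ltW.
Qed.

(* With the weight exp(2 C t), the map [P] is 1/2-contracting. *)
Lemma volterra_contract (u v : L2 V T) (b : R) : 0 <= b ->
  (\ae t \in(0, T), `|u t - v t| <= b * expR (2 * C * t)) ->
  \ae t \in(0, T), `|P u t - P v t| <= b / 2 * expR (2 * C * t).
Proof.
move=> b0 uv.
have h : ae_in T (fun t => \int[lebesgue_measure]_(s in `[0, t]) `|u s - v s|
    <= b / (2 * C) * expR (2 * C * t)).
  apply: ae_in_Ioo => t t0 tT; apply: (Rintegral_le_exp t0 tT) => //.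
  by rewrite mulr_gt0.
apply: filterS2 (PC u v) h => t h1 h2; apply: le_trans h1 _.
have -> : b / 2 * expR (2 * C * t) = C * (b / (2 * C) * expR (2 * C * t)).
  by field; rewrite gt_eqF.
by rewrite ler_wpM2l// ltW.
Qed.

(** Indices start at [n.+1] because only then is the difference bounded. Constant sequences give
    uniqueness, a sequence and its shift give convergence. *)
Lemma volterra_iter (u v : nat -> L2 V T) :
  (forall n, u n.+1 = P (u n)) -> (forall n, v n.+1 = P (v n)) ->
  exists2 E, 0 <= E & forall n, \ae t \in(0, T),
    `|u n.+1 t - v n.+1 t| <= E * 2^-1 ^+ n.
Proof.
move=> uP vP; have [b b0 hb] := volterra_bounded (u 0%N) (v 0%N).
have h n : \ae t \in(0, T),
    `|u n.+1 t - v n.+1 t| <= b * 2^-1 ^+ n * expR (2 * C * t).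
  elim: n => [|n IHn].
    rewrite !uP !vP expr0 mulr1; apply: filterS2 hb (ae_in_Ioo (Q := fun t => 0 < t) _).
      move=> t h1 t0; apply: le_trans h1 _; rewrite ler_peMr// -expR0 ler_expR.
      by rewrite !mulr_ge0// ltW.
    by [].
  rewrite uP vP exprSr mulrA; apply: volterra_contract => //.
  by rewrite mulr_ge0// exprn_ge0.
exists (b * expR (2 * C * T)) => [|n]; first by rewrite mulr_ge0// expR_ge0.
apply: filterS2 (h n) (ae_in_Ioo (Q := fun t => t < T) _) => [t h1 tT|//].
apply: le_trans h1 _; rewrite -!mulrA ler_wpM2l// mulrC ler_wpM2r ?exprn_ge0//.
by rewrite ler_expR !ler_wpM2l//; exact: ltW.
Qed.

Lemma volterra_unique (u v : L2 V T) : P u = u -> P v = v -> u = v.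
Proof.
move=> Pu Pv; have [E E0 h] := @volterra_iter (fun=> u) (fun=> v) (fun=> esym Pu) (fun=> esym Pv).
apply: L2_ext; apply: filterS (ae_in_all h) => t ht.
apply/eqP; rewrite -subr_eq0 -normr_le0; exact: le_geometric0 ht.
Qed.

Lemma volterra_fixpoint : separable V -> exists u : L2 V T, P u = u.
Proof.
move=> sepV; pose w n := iter n P (L2_inhabited T V).
have [E E0 h] := @volterra_iter (fun n => w n.+1) w (fun=> erefl) (fun=> erefl).
(* The estimate is a premise inside the existence claim, so that choice applies at every [t]; the
   null set is removed afterwards. *)
have lP t : exists l, (forall n, `|w n.+2 t - w n.+1 t| <= E * 2^-1 ^+ n) ->
    forall n, `|l - w n.+1 t| <= 2 * E * 2^-1 ^+ n.
  have [ht|nht] := pselect (forall n, `|w n.+2 t - w n.+1 t| <= E * 2^-1 ^+ n); last by exists 0.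
  by have [l] := @geometric_cvg _ _ (fun n => w n.+1 t) E E0 ht; exists l.
have [l {}lP] := choice lP.
have hl : ae_in T (fun t => forall n, `|l t - w n.+1 t| <= 2 * E * 2^-1 ^+ n).
  by apply: filterS (ae_in_all h) => t; exact: lP.
have sl : square_integrable T l.
  apply: square_integrable_dominated.
    apply: (@strongly_measurable_lim _ _ _ (fun n => w n.+1)) => //.
      by move=> n; exact: L2_strongly_measurable.
    apply: filterS hl => t ht; apply/cvgrPdist_le => e e0.
    have [n nP] : exists n, 2 * E * 2^-1 ^+ n <= e.
      apply: contrapT => /forallNP hn; have : e <= 0.
        by apply: (@le_geometric0 _ _ (2 * E)) => n; apply: ltW; rewrite ltNge; apply/negP/hn.
      by rewrite leNgt e0.
    exists n => // k /= nk; apply: le_trans (ht k) (le_trans _ nP).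
    by rewrite ler_wpM2l ?mulr_ge0// ler_wiXn2l// ?invr_ge0// invf_le1// ler1n.
  apply: (@L2_dominatedS _ T _ (fun t => `|w 1%N t| + 2 * E)).
    apply: filterS hl => t /(_ 0%N); rewrite expr0 mulr1 => h0.
    by have := ler_normD (l t - w 1%N t) (w 1%N t); rewrite subrK; lra.
  by apply: L2_dominatedD; [exact: L2_dominated_L2|apply: L2_dominated_cst; rewrite mulr_ge0].
exists (L2_class sl); apply: L2_ext.
have hcl : ae_in T (fun t => forall n, `|L2_class sl t - w n.+1 t| <= 2 * E * 2^-1 ^+ n).
  by apply: filterS2 hl (L2_classE sl) => t + ->.
have hP n : ae_in T (fun t => `|P (L2_class sl) t - w n.+2 t| <= C * (2 * E * 2^-1 ^+ n * T)).
  have hi : ae_in T (fun t => \int[lebesgue_measure]_(s in `[0, t]) `|L2_class sl s - w n.+1 s|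
     <= 2 * E * 2^-1 ^+ n * T).
    apply: ae_in_Ioo => t t0 tT; apply: Rintegral_le_cst => //.
      by rewrite mulr_ge0 ?exprn_ge0// mulr_ge0.
    by apply: filterS hcl.
  apply: filterS2 (PC (L2_class sl) (w n.+1)) hi => t h1 h2; apply: le_trans h1 _.
  by rewrite ler_wpM2l// ltW.
apply: filterS2 (ae_in_all hP) hcl => t h1 h2.
apply/eqP; rewrite -subr_eq0 -normr_le0.
(* [C * (2 * E) * T] comes from applying [P] to the limit and to [w n.+1], and [E] from the distance
   of the limit to [w n.+2]. *)
apply: (@le_geometric0 _ _ (C * (2 * E) * T + E)) => n.
have := h1 n; have := h2 n.+1; rewrite exprS => h3 h4.
have := ler_normD (P (L2_class sl) t - w n.+2 t) (w n.+2 t - L2_class sl t).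
rewrite addrA subrK (distrC (w n.+2 t)); move: h3 h4; set p := 2^-1 ^+ n; lra.
Qed.

End Volterra.

(** * The pointwise inequality *)

Lemma dualD (R : realType) (V : normedModType R) (g : dual V) (x y : V) :
  g (x + y) = g x + g y :> R.
Proof. exact: (linearD g). Qed.

Lemma dualB (R : realType) (V : normedModType R) (g : dual V) (x y : V) :
  g (x - y) = g x - g y :> R.
Proof. exact: (linearB g). Qed.

Lemma dualZ (R : realType) (V : normedModType R) (g : dual V) (l : R) (x : V) :
  g (l *: x) = l * g x :> R.
Proof. exact: (linearZZ g). Qed.

Lemma dual_subE (R : realType) (V : normedModType R) (g g' : dual V) (x : V) :
  (g - g') x = g x - g' x :> R.
Proof. by []. Qed.

Section Convexity.
Context (R : realType) (V : normedModType R) (K : set V).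

Lemma convex_set_convex2 : convex_set (K : set (convex_lmodType V)) -> convex2 K.
Proof.
move=> cK x y s Kx Ky s0 s1.
have := cK y x (Itv01 s0 s1); rewrite !inE => /(_ Ky Kx).
by rewrite addrC.
Qed.

Lemma convex_function_convex2 (g : V -> R) :
  convex_function (K : set (convex_lmodType V)) (g : V -> R^o) -> convex2_fun K g.
Proof.
move=> cg x y s Kx Ky s0 s1.
have := cg (Itv01 s0 s1) y x; rewrite !inE => /(_ Ky Kx).
by rewrite addrC [leRHS]addrC.
Qed.

Lemma lower_semicontinuous_lsc_on (g : V -> R) :
  lower_semicontinuous (fun v : subspace K => (g v)%:E) -> lsc_on K g.
Proof.
move=> lg u e Ku e0; have [|U uU UP] := lg u (g u - e).
  by rewrite lte_fin ltrBlDr ltrDl.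
have : within K (nbhs u) U by rewrite nbhs_subspace_in.
move=> /nbhs_ballP[r /= r0 rU]; exists r => // v Kv vr.
have := UP v (rU v _ Kv); rewrite lte_fin -ball_normE /ball_ /= distrC => h.
exact/ltW/h.
Qed.

End Convexity.

Section HemivariationalGap.
Context (R : realType) (V X : normedModType R).
Implicit Types (u v d : V) (w f : dual V).
Context (K : set V) (M : blin V X).
Context (m_A a_0 a_1 c_0 c_1 m_J alpha : R) (phi : dual V -> V -> V -> R) (v0 : V).
Hypotheses (a_1_ge0 : 0 <= a_1) (c_1_ge0 : 0 <= c_1)
  (m_J_ge0 : 0 <= m_J) (alpha_ge0 : 0 <= alpha).
Hypothesis Kv0 : K v0.
Hypothesis phi_convex : forall w u, K u -> convex2_fun K (phi w u).
Hypothesis phi_lsc : forall w u, K u -> lsc_on K (phi w u).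
Hypothesis phi_ineq : forall w1 w2 u1 u2 v1 v2,
     K u1 -> K u2 -> K v1 -> K v2 ->
     phi w1 u1 v2 - phi w1 u1 v1 + phi w2 u2 v1 - phi w2 u2 v2 <=
       alpha * (`|u1 - u2| + `|w1 - w2|) * `|v1 - v2|.

Record admissible (a0 c0 : R) (a : V -> dual V) (h : X -> R) : Prop := {
  adm_mono : forall v1 v2, m_A * `|v1 - v2| ^+ 2 <= (a v1 - a v2) (v1 - v2);
  adm_cont : continuous a;
  adm_a0 : 0 <= a0;
  adm_growth : forall v, `|a v| <= a0 + a_1 * `|v|;
  adm_lip : locally_lipschitz h;
  adm_c0 : 0 <= c0;
  adm_subdiff : forall x zeta, clarke_subdiff h x zeta -> `|zeta| <= c0 + c_1 * `|x|;
  adm_relaxed : forall x1 x2,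
    clarke h x1 (x2 - x1) + clarke h x2 (x1 - x2) <= m_J * `|x1 - x2| ^+ 2 }.

Definition hvi_gap (a : V -> dual V) (h : X -> R) f w u v : R :=
  (a u - f) (v - u) + (phi w u v - phi w u u) + clarke h (M u) (M (v - u)).

Context (a0 c0 : R) (a : V -> dual V) (h : X -> R) (f : dual V).
Hypothesis ah : admissible a0 c0 a h.
Let m := m_A - alpha - m_J * `|M| ^+ 2.
Let F w := hvi_gap a h f w.

Let normM x : `|M x| <= `|M| * `|x|. Proof. exact: opnormP. Qed.

Let hsub x := clarke_sublinear (adm_lip ah) x.

(** Two parameters are allowed: [w1 = w2] gives strong monotonicity, distinct ones the stability of
    solutions. *)
Lemma hvi_gap_monotone w1 w2 u1 u2 : K u1 -> K u2 ->
  F w1 u1 u2 + F w2 u2 u1 <=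
    - (m * `|u1 - u2| ^+ 2) + alpha * `|w1 - w2| * `|u1 - u2|.
Proof.
move=> Ku1 Ku2; rewrite /F /hvi_gap.
have h1 := adm_mono ah u1 u2.
have h2 := phi_ineq w1 w2 Ku1 Ku2 Ku1 Ku2.
have := adm_relaxed ah (M u1) (M u2); rewrite -!linearB => h3.
have h4 : m_J * `|M (u1 - u2)| ^+ 2 <= m_J * (`|M| ^+ 2 * `|u1 - u2| ^+ 2).
  rewrite ler_wpM2l// -exprMn lerXn2r ?nnegrE// ?mulr_ge0//.
move: h1; rewrite !dual_subE !dualB => h1.
by rewrite /m; lra.
Qed.

(** [phi_ineq] with second pair [(0, v0)] replaces increments of [phi w v] by those of [phi 0 v0],
    up to a Lipschitz error. *)
Lemma hvi_gap_lip w v d e : K v -> K d -> K e ->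
  F w v d - F w v e <= (a0 + a_1 * `|v| + `|f| + alpha * (`|v - v0| + `|w|) +
     (c0 + c_1 * (`|M| * `|v|)) * `|M|) * `|d - e| + (phi 0 v0 d - phi 0 v0 e).
Proof.
move=> Kv Kd Ke; rewrite /F /hvi_gap.
have h1 := phi_ineq w 0 Kv Kv0 Ke Kd; rewrite subr0 (distrC e d) in h1.
have h2 : clarke h (M v) (M (d - v)) <= clarke h (M v) (M (e - v)) + clarke h (M v) (M (d - e)).
  apply: le_trans ((hsub (M v)).1 _ _).
  by rewrite -linearD (_ : e - v + (d - e) = d - v)// addrC addrA subrK.
have h3 : clarke h (M v) (M (d - e)) <= (c0 + c_1 * (`|M| * `|v|)) * `|M| * `|d - e|.
  have hs z : clarke_subdiff h (M v) z -> `|z| <= c0 + c_1 * `|M v|.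
    exact: (adm_subdiff ah).
  have := clarke_le_subdiff (adm_lip ah) (M (d - e)) hs.
  move=> /le_trans; apply; rewrite -mulrA.
  have hc : 0 <= c0 + c_1 * `|M v| by rewrite addr_ge0 ?(adm_c0 ah)// mulr_ge0.
  apply: ler_pM => //; first by rewrite lerD2l ler_wpM2l.
have h4 : (a v) (d - e) <= (a0 + a_1 * `|v|) * `|d - e|.
  by apply: le_trans (dual_le _ _) _; rewrite ler_wpM2r// (adm_growth ah).
have h5 := dual_ge f (d - e).
move: h4 h5; rewrite !dual_subE !dualB => h4 h5; lra.
Qed.

(** No continuity of [phi] in its second argument is given. [phi_ineq] moves it from [u'] to [u] at
    a cost of order [|u' - u|], after which semicontinuity in the last argument applies. *)
Lemma hvi_gap_usc w v : K v -> lsc_on K (fun u => - F w u v).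
Proof.
move=> Kv u e Ku e0.
have [r1 r10 r1P] := clarke_usc (adm_lip ah) (M u) (M (v - u)) (divr_gt0 e0 (ltr0n _ 4)).
have [r2 r20 r2P] := phi_lsc w Ku Ku (divr_gt0 e0 (ltr0n _ 4)).
pose c := (1 + alpha) * (`|v - u| + 1) + `|a u - f|.
have c0' : 0 < c.
  have A0 : 0 < 1 + alpha by rewrite ltr_pwDl.
  have B0 : 0 < `|v - u| + 1 by rewrite ltr_wpDl.
  by rewrite /c ltr_pwDl// mulr_gt0.
pose eta := Num.min (Num.min 1 r2) (Num.min (r1 / (`|M| + 1)) (e / 4 / c)).
have M1 : 0 < `|M| + 1 by rewrite ltr_wpDl.
have eta0 : 0 < eta by rewrite !lt_min ltr01 r20 !divr_gt0.
have au0 : a u' @[u' --> u] --> a u by exact: (adm_cont ah).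
have /cvgrPdist_lt /(_ eta eta0) /nbhs_ballP[r3 /= r30 r3P] := au0.
exists (Num.min r3 eta); first by rewrite lt_min r30.
move=> u' Ku'; rewrite lt_min => /andP[u3 ue].
have {r3P}au : `|a u - a u'| < eta by apply: r3P; rewrite -ball_normE /ball_ /= distrC.
have eta1 : eta <= 1 by rewrite !ge_min lexx.
have etac : eta * c <= e / 4 by rewrite -ler_pdivlMr// !ge_min lexx !orbT.
have etaM : eta * (`|M| + 1) <= r1 by rewrite -ler_pdivlMr// !ge_min lexx !orbT.
have etar2 : eta <= r2 by rewrite !ge_min lexx !orbT.
have vu' : `|v - u'| <= `|v - u| + 1.
  by have := ler_normD (v - u) (u - u'); rewrite addrA subrK (distrC u); lra.
have n0 : 0 <= `|u' - u| by [].
have Mu : `|M| * `|u' - u| < r1.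
  have : `|M| * `|u' - u| <= (`|M| + 1) * `|u' - u| by rewrite ler_wpM2r//; lra.
  have : (`|M| + 1) * `|u' - u| < (`|M| + 1) * eta by rewrite ltr_pM2l.
  lra.
have h1 : clarke h (M u') (M (v - u')) <= clarke h (M u) (M (v - u)) + e / 4.
  apply: r1P.
    by rewrite -linearB; exact: le_lt_trans (normM _) Mu.
  rewrite -linearB; apply: le_lt_trans (normM _) _.
  by rewrite (_ : v - u' - (v - u) = u - u') 1?distrC// opprB addrC addrA subrK.
have h2 := phi_ineq w w Ku' Ku Ku' Kv; rewrite subrr normr0 addr0 in h2.
have h3 := r2P u' Ku' (lt_le_trans ue etar2).
have h4 := dual_le (a u' - a u) (v - u').
have h5 := dual_le (a u - f) (u - u').
have b1 : `|a u' - a u| * `|v - u'| <= eta * (`|v - u| + 1).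
  by apply: ler_pM => //; rewrite distrC ltW.
have b2 : `|a u - f| * `|u - u'| <= `|a u - f| * eta.
  by rewrite ler_wpM2l// distrC ltW.
have b3 : alpha * `|u' - u| * `|u' - v| <= alpha * (eta * (`|v - u| + 1)).
  rewrite -mulrA; apply: ler_wpM2l => //.
  by apply: ler_pM => //; [exact: ltW|rewrite (distrC u')].
rewrite /= /F /hvi_gap; move: h4 h5; rewrite !dual_subE !dualB => h4 h5.
move: etac; rewrite /c; lra.
Qed.

Lemma hvi_gap_bifunction w : bifunction K (phi 0 v0) m (F w).
Proof.
split.
- move=> u Ku; rewrite /F /hvi_gap !subrr addr0 linear0 linear0.
  by rewrite (sublinear0 (hsub _)) !addr0.
- move=> u v Ku Kv; have := hvi_gap_monotone w w Ku Kv.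
  by rewrite subrr normr0 mulr0 mul0r addr0.
- move=> u Ku v v' s Kv Kv' s0 s1; rewrite /F /hvi_gap.
  have -> : (1 - s) *: v + s *: v' - u = (1 - s) *: (v - u) + s *: (v' - u).
    by rewrite !scalerBr addrACA -opprD -scalerDl subrK scale1r.
  rewrite (linearD M) !(linearZZ M).
  have h1 := phi_convex w Ku Kv Kv' s0 s1.
  have h2 := (hsub (M u)).1 ((1 - s) *: M (v - u)) (s *: M (v' - u)).
  rewrite !(hsub (M u)).2 ?subr_ge0// in h2.
  rewrite (dualD _ ((1 - s) *: (v - u))) !dualZ; lra.
- have L1 : 0 <= a0 + `|f| + alpha * (`|v0| + `|w|) + c0 * `|M|.
    by rewrite !addr_ge0 ?(adm_a0 ah)// !mulr_ge0// ?addr_ge0// (adm_c0 ah).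
  have L2 : 0 <= a_1 + alpha + c_1 * `|M| * `|M|.
    by rewrite !addr_ge0// !mulr_ge0.
  exists (a0 + `|f| + alpha * (`|v0| + `|w|) + c0 * `|M| + (a_1 + alpha + c_1 * `|M| * `|M|)).
    exact: addr_ge0.
  move=> v d e Kv Kd Ke; apply: le_trans (hvi_gap_lip w Kv Kd Ke) _.
  rewrite lerD2r ler_wpM2r//.
  have h1 : alpha * `|v - v0| <= alpha * (`|v| + `|v0|).
    by rewrite ler_wpM2l// ler_normB.
  have := mulr_ge0 L1 (normr_ge0 v); lra.
- by move=> v Kv; exact: hvi_gap_usc.
Qed.

Lemma hvi_stable w1 w2 u1 u2 : 0 < m -> equilibrium K (F w1) u1 ->
  equilibrium K (F w2) u2 -> m * `|u1 - u2| <= alpha * `|w1 - w2|.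
Proof.
move=> m0 [Ku1 h1] [Ku2 h2]; have h3 := hvi_gap_monotone w1 w2 Ku1 Ku2.
have [->|u12] := eqVneq u1 u2; first by rewrite subrr normr0 mulr0 mulr_ge0.
have n0 : 0 < `|u1 - u2| by rewrite normr_gt0 subr_eq0.
rewrite -(ler_pM2r n0); have := h1 _ Ku2; have := h2 _ Ku1; move: h3; lra.
Qed.

(** Testing with [v0] gives [m r^2 <= 1 + H r], hence a bound affine in [a0], [c0] and the norms of
    [f] and [w], which therefore inherits square integrability in [t]. *)
Lemma hvi_bound w u c : 0 < m -> equilibrium K (F w) u -> 0 <= c ->
  (forall v, K v -> phi 0 v0 v0 - 1 - c * `|v - v0| <= phi 0 v0 v) ->
  `|u| <= `|v0| + 1 + m^-1 * (1 + (a0 + a_1 * `|v0| + `|f| + alpha * `|w| + c +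
     (c0 + c_1 * (`|M| * `|v0|)) * `|M|)).
Proof.
move=> m0 [Ku uP] cge0 phic; have h1 := uP v0 Kv0.
have h2 := hvi_gap_monotone w w Ku Kv0.
rewrite subrr normr0 mulr0 mul0r addr0 in h2.
have h3 := hvi_gap_lip w Kv0 Kv0 Ku.
rewrite (bif_diag (hvi_gap_bifunction w) Kv0) subrr normr0 !add0r (distrC v0) in h3.
have h4 := phic u Ku.
set H := _ + _ * `|M|; set r := `|u - v0| in h2 h3 h4.
have H0 : 0 <= H.
  by rewrite /H !addr_ge0 ?(adm_a0 ah)// mulr_ge0// addr_ge0 ?(adm_c0 ah)// mulr_ge0// mulr_ge0.
have h5 : m * r ^+ 2 <= 1 + H * r by rewrite /H; lra.
have : `|u| <= r + `|v0| by rewrite -{1}(subrK v0 u); exact: ler_normD.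
suff : r <= 1 + m^-1 * (1 + H) by lra.
have H1 : 0 <= m^-1 * (1 + H) by rewrite mulr_ge0 ?invr_ge0 ?(ltW m0)// addr_ge0.
have [r1|r1] := leP r 1; first by apply: le_trans r1 _; rewrite lerDl.
have : m * r <= 1 + H.
  rewrite -(ler_pM2r (lt_trans ltr01 r1)) -mulrA -expr2; apply: le_trans h5 _.
  by rewrite [leRHS]mulrDl mul1r lerD2r ltW.
by rewrite mulrC -ler_pdivlMr// mulrC => /le_trans; apply; rewrite lerDr.
Qed.

End HemivariationalGap.

(** * The evolutionary inequality *)

Lemma lipschitz_bound_continuous (R : realType) (W : normedModType R) (g : W -> R)
    (c : R) : 0 <= c -> (forall x y, `|g x - g y| <= c * `|x - y|) ->
  continuous (g : W -> R^o).
Proof.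
move=> c0 gc x; apply/cvgrPdist_lt => e e0.
have c1 : 0 < c + 1 by rewrite ltr_wpDl.
near=> y.
apply: le_lt_trans (gc x y) _; apply: (@le_lt_trans _ _ (`|x - y| * (c + 1))).
  by rewrite mulrC ler_wpM2l// lerDl.
rewrite -ltr_pdivlMr//; near: y.
by apply: (@cvgr_dist_lt _ _ _ _ _ id) => //; rewrite divr_gt0.
Unshelve. all: by end_near. Qed.

Section WellPosedness.
Context (R : realType) (V X : completeNormedModType R).
Context (T : R) (K : set V) (M : blin V X).
Context (m_A a_1 c_1 m_J alpha : R) (phi : dual V -> V -> V -> R) (v0 : V).
Context (A : R -> V -> dual V) (J : R -> X -> R) (a_0 c_0 : R -> R^o) (f : R -> dual V).
Let m := m_A - alpha - m_J * `|M| ^+ 2.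
Let G t := hvi_gap M phi (A t) (J t) (f t).

Hypotheses (sepV : separable V) (reflV : reflexive_space V) (sepX : separable X).
Hypotheses (Kcl : closed K) (Kcvx : convex2 K) (Kv0 : K v0).
Hypotheses (a_1_ge0 : 0 <= a_1) (c_1_ge0 : 0 <= c_1) (m_J_ge0 : 0 <= m_J)
  (alpha_ge0 : 0 <= alpha) (m_gt0 : 0 < m).
Hypothesis phi_convex : forall w u, K u -> convex2_fun K (phi w u).
Hypothesis phi_lsc : forall w u, K u -> lsc_on K (phi w u).
Hypothesis phi_ineq : forall w1 w2 u1 u2 v1 v2,
     K u1 -> K u2 -> K v1 -> K v2 ->
     phi w1 u1 v2 - phi w1 u1 v1 + phi w2 u2 v1 - phi w2 u2 v2 <=
       alpha * (`|u1 - u2| + `|w1 - w2|) * `|v1 - v2|.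
Hypothesis A_meas : forall v, strongly_measurable T (A^~ v).
Hypothesis J_meas : forall x, strongly_measurable T (fun t => J t x : R^o).
Hypothesis f_sq : square_integrable T f.
Hypothesis a_0_sq : square_integrable T a_0.
Hypothesis c_0_sq : square_integrable T c_0.
Hypothesis AJ : \ae t \in(0, T),
  admissible m_A a_1 c_1 m_J (a_0 t) (c_0 t) (A t) (J t).

Lemma hvi_gap_aemeas (w : R -> dual V) u v : K u -> K v ->
  strongly_measurable T w ->
  aemeas T (fun t => (G t (w t) u v)%:E).
Proof.
move=> Ku Kv mw; rewrite /G /hvi_gap.
have dual_eval_cont (x : V) : continuous ((fun z : dual V => z x : R) : dual V -> R^o).
  apply: (lipschitz_bound_continuous (normr_ge0 x)) => z z'.
  by rewrite mulrC; exact: (dual_norm_ge (z - z') x).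
have mA : aemeas T (EFin \o (fun t => (A t u) (v - u) : R)).
  exact: (aemeas_comp (c := fun z : dual V => z (v - u) : R)) (A_meas u) (dual_eval_cont _).
have mf : aemeas T (EFin \o (fun t => (f t) (v - u) : R)).
  exact: (aemeas_comp (c := fun z : dual V => z (v - u) : R)) f_sq.1 (dual_eval_cont _).
(* The difference is Lipschitz in [z], by [phi_ineq] with equal second arguments. *)
have phi_cont : continuous ((fun z => phi z u v - phi z u u) : dual V -> R^o).
  have c0 : 0 <= alpha * `|v - u| by rewrite mulr_ge0.
  apply: (lipschitz_bound_continuous c0) => z z'.
  have h1 := phi_ineq z z' Ku Ku Ku Kv.
  have h2 := phi_ineq z' z Ku Ku Ku Kv.
  rewrite subrr normr0 add0r (distrC u) in h1.
  rewrite subrr normr0 add0r (distrC u) (distrC z') in h2.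
  by rewrite ler_norml; apply/andP; split; lra.
have mphi : aemeas T (EFin \o (fun t => phi (w t) u v - phi (w t) u u)).
  exact: aemeas_comp mw phi_cont.
have mJ : aemeas T (EFin \o (fun t => clarke (J t) (M u) (M (v - u)))).
  apply: aemeas_fine; apply: aemeas_clarke => //.
  by apply: filterS AJ => t; exact: adm_lip.
exact: (aemeasD (aemeasD (aemeasD mA (aemeasN mf)) mphi) mJ).
Qed.

Lemma hvi_solution_exists (w : R -> dual V) : square_integrable T w ->
  exists u : L2 V T, \ae t \in(0, T), equilibrium K (G t (w t)) (u t).
Proof.
move=> w_sq.
have [D Dd] := graph_dense_exists (K := K) (phi 0 v0) sepV (ex_intro _ v0 Kv0).
have bif t : admissible m_A a_1 c_1 m_J (a_0 t) (c_0 t) (A t) (J t) ->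
    bifunction K (phi 0 v0) m (G t (w t)).
  by move=> adm; exact: (hvi_gap_bifunction M a_1_ge0 c_1_ge0 m_J_ge0 alpha_ge0 Kv0
    phi_convex phi_lsc phi_ineq (f t) adm).
have uex t : exists u, admissible m_A a_1 c_1 m_J (a_0 t) (c_0 t) (A t) (J t) ->
    equilibrium K (G t (w t)) u.
  have [adm|nadm] := pselect (admissible m_A a_1 c_1 m_J (a_0 t) (c_0 t) (A t) (J t));
    last by exists 0.
  have [u uP] := equilibrium_exists m_gt0 Kcvx (bif t adm) Dd reflV Kcl
    (phi_convex 0 Kv0) (phi_lsc 0 Kv0).
  by exists u.
have [u uP] := choice uex.
have ueq : \ae t \in(0, T), equilibrium K (G t (w t)) (u t).
  by apply: filterS AJ => t; exact: uP.
have u_meas : strongly_measurable T u.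
  (* The gap of [D j] is a countable supremum, hence measurable in [t]; [minty_gap_inf] and
     [minty_gap] supply the two conditions. *)
  apply: (@strongly_measurable_select _ _ _ D
    (fun j t => ereal_sup (range (fun i => (G t (w t) (D i) (D j))%:E)))).
    move=> j; apply: (@aemeas_ereal_sup _ _ (fun i t => (G t (w t) (D i) (D j))%:E)) => i.
    by apply: hvi_gap_aemeas; [exact: Dd.1|exact: Dd.1|exact: w_sq.1].
  apply: filterS2 AJ ueq => t adm ut; split=> [e e0|d d0].
    have [j jP] := minty_gap_inf m_gt0 (bif t adm) Dd ut e0.
    exists j; apply: ge_ereal_sup => _ [i _ <-]; rewrite lee_fin; exact: jP.
  (* The level at which the estimate [4 * e] of [minty_gap] becomes [m * d ^+ 2]. *)
  exists (m * d ^+ 2 / 4); first by rewrite divr_gt0// mulr_gt0// exprn_gt0//.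
  move=> j hj; have := minty_gap Kcvx (bif t adm) Dd ut (Dd.1 j) (e := m * d ^+ 2 / 4).
  have -> : 4 * (m * d ^+ 2 / 4) = m * d ^+ 2 by field.
  rewrite ler_pM2l// => h.
  rewrite -(@ler_pXn2r _ 2)// ?nnegrE ?(ltW d0)//; apply: h.
    by rewrite divr_ge0// mulr_ge0 ?sqr_ge0// ltW.
  move=> i; rewrite -lee_fin; apply: le_trans hj; apply: ereal_sup_ubound.
  by exists i.
have [c cge0 cP] := convex_lsc_minorant Kcvx (phi_convex 0 Kv0) (phi_lsc 0 Kv0) Kv0.
have u_dom : L2_dominated T (fun t => `|u t|).
  apply: (@L2_dominatedS _ _ _ (fun t => (`|v0| + 1) + m^-1 * (1 +
    (`|a_0 t| + a_1 * `|v0| + `|f t| + alpha * `|w t| + c +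
     (`|M| * `|c_0 t| + c_1 * (`|M| * `|v0|) * `|M|))))).
    apply: filterS2 AJ ueq => t adm ut.
    have := hvi_bound a_1_ge0 c_1_ge0 m_J_ge0 alpha_ge0 Kv0 phi_convex phi_lsc phi_ineq adm
      m_gt0 ut cge0 cP.
    move=> /le_trans; apply; rewrite lerD2l ler_wpM2l ?invr_ge0 ?(ltW m_gt0)//.
    rewrite lerD2l (ger0_norm (adm_a0 adm)) lerD2l (ger0_norm (adm_c0 adm)).
    by rewrite mulrDl (mulrC (c_0 t)).
  have cst x : 0 <= x -> L2_dominated T (fun=> x) by exact: L2_dominated_cst.
  apply: L2_dominatedD; first by apply: cst; rewrite addr_ge0.
  apply: L2_dominatedZ; first by rewrite invr_ge0 ltW.
  apply: L2_dominatedD; first exact: cst.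
  apply: L2_dominatedD.
    apply: L2_dominatedD; last exact: cst.
    apply: L2_dominatedD; last first.
      by apply: L2_dominatedZ => //; exact: L2_dominated_norm.
    apply: L2_dominatedD; last exact: L2_dominated_norm.
    apply: L2_dominatedD; first exact: L2_dominated_norm.
    by apply: cst; rewrite mulr_ge0.
  apply: L2_dominatedD.
    by apply: L2_dominatedZ => //; exact: L2_dominated_norm.
  by apply: cst; rewrite !mulr_ge0.
have u_sq := square_integrable_dominated u_meas u_dom; exists (L2_class u_sq).
by apply: filterS2 ueq (L2_classE u_sq) => t + ->.
Qed.

Context (S : L2 V T -> L2 (dual V) T) (L_S : R).
Hypotheses (L_S_gt0 : 0 < L_S) (alpha_gt0 : 0 < alpha).
Hypothesis S_history : forall u1 u2 : L2 V T, \ae t \in(0, T),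
     `|S u1 t - S u2 t| <=
       L_S * \int[lebesgue_measure]_(s in `[0, t]) `|u1 s - u2 s|.

Lemma hvi_history_wellposed : exists! u : L2 V T,
  \ae t \in(0, T), equilibrium K (G t (S u t)) (u t).
Proof.
have solP u : exists Pu : L2 V T, \ae t \in(0, T), equilibrium K (G t (S u t)) (Pu t).
  by apply: hvi_solution_exists; exact: L2_square_integrable.
have [P PP] := choice solP.
have stable (w1 w2 : R -> dual V) (u1 u2 : L2 V T) :
    (\ae t \in(0, T), equilibrium K (G t (w1 t)) (u1 t)) ->
    (\ae t \in(0, T), equilibrium K (G t (w2 t)) (u2 t)) ->
    \ae t \in(0, T), m * `|u1 t - u2 t| <= alpha * `|w1 t - w2 t|.
  move=> h1 h2; apply: filterS (filterI AJ (filterI h1 h2)) => t [adm [e1 e2]].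
  exact: (hvi_stable m_J_ge0 alpha_ge0 phi_ineq adm m_gt0 e1 e2).
have PC (u v : L2 V T) : \ae t \in(0, T), `|P u t - P v t| <=
    alpha / m * L_S * \int[lebesgue_measure]_(s in `[0, t]) `|u s - v s|.
  apply: filterS2 (stable _ _ _ _ (PP u) (PP v)) (S_history u v) => t h1 h2.
  have -> : alpha / m * L_S = m^-1 * (alpha * L_S) by rewrite mulrAC mulrC.
  rewrite -mulrA ler_pdivlMl// -mulrA.
  by apply: le_trans h1 _; exact: ler_wpM2l.
have C0 : 0 < alpha / m * L_S by rewrite mulr_gt0// divr_gt0.
(* Stability with equal parameters shows that [u] and [P u], solutions of the same frozen problem,
   coincide. *)
have fixP u : (\ae t \in(0, T), equilibrium K (G t (S u t)) (u t)) -> P u = u.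
  move=> ueq; apply: L2_ext.
  apply: filterS (stable _ _ _ _ (PP u) ueq) => t.
  rewrite subrr normr0 mulr0 pmulr_rle0// normr_le0 subr_eq0.
  by move/eqP.
have [u Pu] := volterra_fixpoint C0 PC sepV.
exists u; split; first by rewrite -{2}Pu; exact: PP.
by move=> v /fixP Pv; exact: (volterra_unique C0 PC).
Qed.

End WellPosedness.

Theorem theorem13 (R : realType) (V X : completeNormedModType R)
  (sepV : separable V) (reflV : reflexive_space V)
  (sepX : separable X) (reflX : reflexive_space X)
  (T : R) (T_gt0 : 0 < T)
  (K : set V) (K_neq0 : K !=set0) (K_closed : closed K)
  (K_convex : convex_set (K : set (convex_lmodType V)))
  (M : blin V X) (M_compact : compact_operator M)
  (* (1) *)
  (A : R -> V -> dual V) (m_A a_1 alpha_A beta : R) (a_0 beta_1 : L2 R^o T)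
  (u_0 : V)
  (A_meas : forall v, strongly_measurable T (A^~ v))
  (m_A_gt0 : 0 < m_A)
  (A_monotone : \ae t \in(0, T), forall v1 v2 : V,
     m_A * `|v1 - v2| ^+ 2 <= (A t v1 - A t v2) (v1 - v2))
  (A_continuous : \ae t \in(0, T), continuous (A t))
  (a_0_ge0 : \ae t \in(0, T), 0 <= a_0 t) (a_1_gt0 : 0 < a_1)
  (A_growth : \ae t \in(0, T), forall v : V,
     `|A t v| <= a_0 t + a_1 * `|v|)
  (alpha_A_gt0 : 0 < alpha_A) (u_0_in_K : K u_0)
  (A_coercive : \ae t \in(0, T), forall v : V,
     alpha_A * `|v| ^+ 2 - beta * `|v| - beta_1 t <= A t v (v - u_0))
  (* (2) *)
  (S : L2 V T -> L2 (dual V) T) (L_S : R) (L_S_gt0 : 0 < L_S)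
  (S_history : forall u1 u2 : L2 V T, \ae t \in(0, T),
     `|S u1 t - S u2 t| <=
       L_S * \int[lebesgue_measure]_(s in `[0, t]) `|u1 s - u2 s|)
  (* (3) *)
  (phi : dual V -> V -> V -> R) (alpha_phi : R)
  (phi_convex : forall w u, K u ->
     convex_function (K : set (convex_lmodType V)) (phi w u))
  (phi_lsc : forall w u, K u ->
     lower_semicontinuous (fun v : subspace K => (phi w u v)%:E))
  (alpha_phi_gt0 : 0 < alpha_phi)
  (phi_ineq : forall (w1 w2 : dual V) (u1 u2 v1 v2 : V),
     K u1 -> K u2 -> K v1 -> K v2 ->
     phi w1 u1 v2 - phi w1 u1 v1 + phi w2 u2 v1 - phi w2 u2 v2 <=
       alpha_phi * (`|u1 - u2| + `|w1 - w2|) * `|v1 - v2|)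
  (* (4) *)
  (J : R -> X -> R) (c_0 : L2 R^o T) (c_1 m_J : R)
  (J_meas : forall x, strongly_measurable T (fun t => J t x : R^o))
  (J_lipschitz : \ae t \in(0, T), locally_lipschitz (J t))
  (c_0_ge0 : \ae t \in(0, T), 0 <= c_0 t) (c_1_ge0 : 0 <= c_1)
  (J_growth : \ae t \in(0, T), forall (x : X) (zeta : dual X),
     clarke_subdiff (J t) x zeta -> `|zeta| <= c_0 t + c_1 * `|x|)
  (J_regular : \ae t \in(0, T),
     clarke_regular (J t) \/ clarke_regular (fun x => - J t x))
  (m_J_gt0 : 0 < m_J)
  (J_relaxed : \ae t \in(0, T), forall x1 x2 : X,
     (clarke_deriv (J t) x1 (x2 - x1)%R + clarke_deriv (J t) x2 (x1 - x2)%R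
        <= (m_J * `|x1 - x2| ^+ 2)%R%:E)%E)
  (* (5) *)
  (f : L2 (dual V) T)
  (m_A_large : alpha_phi + m_J * `|M| ^+ 2 < m_A)
  (alpha_A_large : 2 * m_J * `|M| ^+ 2 < alpha_A) :
  exists! u : L2 V T,
    (\ae t \in(0, T), K (u t)) /\
    (\ae t \in(0, T), forall v : V, K v ->
      ((f t (v - u t))%R%:E <=
       (A t (u t) (v - u t) + phi (S u t) (u t) v - phi (S u t) (u t) (u t))%R%:E
       + clarke_deriv (J t) (M (u t)) (M (v - u t))%R)%E).
Proof.
have psub : m_A - alpha_phi - m_J * `|M| ^+ 2 > 0 by lra.
have AJ : \ae t \in(0, T), admissible m_A a_1 c_1 m_J (a_0 t) (c_0 t) (A t) (J t).
  apply: filterS (filterI A_monotone (filterI A_continuous (filterI a_0_ge0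
    (filterI A_growth (filterI J_lipschitz (filterI c_0_ge0
    (filterI J_growth J_relaxed))))))).
  move=> t [h1 [h2 [h3 [h4 [h5 [h6 [h7 h8]]]]]]]; split=> // x1 x2.
  by have := h8 x1 x2; rewrite !clarke_derivE// -EFinD lee_fin.
(* For locally Lipschitz [J t] the Clarke derivative is finite, so the extended-real inequality is
   the real one defining an equilibrium. *)
have solE (u : L2 V T) :
  ((\ae t \in(0, T), K (u t)) /\
    (\ae t \in(0, T), forall v : V, K v ->
      ((f t (v - u t))%R%:E <=
       (A t (u t) (v - u t) + phi (S u t) (u t) v - phi (S u t) (u t) (u t))%R%:E
       + clarke_deriv (J t) (M (u t)) (M (v - u t))%R)%E)) <->
  \ae t \in(0, T), equilibrium K (hvi_gap M phi (A t) (J t) (f t) (S u t)) (u t).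
  split=> [[Ku uP]|uP].
    apply: filterS (filterI J_lipschitz (filterI Ku uP)) => t [Jt [Kut ut]].
    split=> // v Kv; have := ut v Kv; rewrite clarke_derivE// -EFinD lee_fin.
    by rewrite /hvi_gap dual_subE; lra.
  split; first by apply: filterS uP => t [].
  apply: filterS2 J_lipschitz uP => t Jt [Kut ut] v Kv.
  have := ut v Kv; rewrite clarke_derivE// -EFinD lee_fin /hvi_gap dual_subE; lra.
have phi_cvx w v : K v -> convex2_fun K (phi w v).
  by move=> Kv; exact/convex_function_convex2/phi_convex.
have phi_lsc' w v : K v -> lsc_on K (phi w v).
  by move=> Kv; exact/lower_semicontinuous_lsc_on/phi_lsc.
have [u [uP uU]] := hvi_history_wellposed sepV reflV sepX K_closed
  (convex_set_convex2 K_convex) u_0_in_K (ltW a_1_gt0) c_1_ge0 (ltW m_J_gt0)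
  (ltW alpha_phi_gt0) psub phi_cvx phi_lsc' phi_ineq A_meas J_meas
  (L2_square_integrable f) (L2_square_integrable a_0) (L2_square_integrable c_0)
  AJ L_S_gt0 alpha_phi_gt0 S_history.
exists u; split; first exact/solE.
by move=> v /solE; exact: uU.
Qed.
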